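(* If a complete first-order theory $T$ is dp-minimal, then $T$ has UDTFS.
   Context: Work in a monster model $\mathfrak{C}$ of $T$; formulas are $\emptyset$-definable. An ICT pattern consists of formulas $\varphi(x;\overline{y})$, $\psi(x;\overline{z})$ with a single free variable $x$ and sequences $\langle\overline{b}_i : i<\omega\rangle$, $\langle\overline{c}_j : j<\omega\rangle$ such that for all $\ell,k<\omega$ the partial type $\{\varphi(x;\overline{b}_\ell),\psi(x;\overline{c}_k)\}\cup\{\neg\varphi(x;\overline{b}_i): i\neq\ell\}\cup\{\neg\psi(x;\overline{c}_j): j\neq k\}$ is consistent. $T$ is dp-minimal if there is no ICT pattern. For $B \subseteq \mathfrak{C}^{\mathrm{lg}(\overline{y})}$, $S_\varphi(B)$ is the set of $\varphi$-types over $B$: maximal consistent sets of formulas $\varphi(\overline{x};\overline{b})$ or $\neg\varphi(\overline{x};\overline{b})$ with $\overline{b}\in B$. A formula $\psi(\overline{y})$ (possibly with parameters) defines $p\in S_\varphi(B)$ if for all $\overline{b}\in B$, $\models\psi(\overline{b})$ iff $\varphi(\overline{x};\overline{b})\in p$. A partitioned formula $\varphi(\overline{x};\overline{y})$ has UDTFS if there is a formula $\psi(\overline{y}; \overline{z}_0,\dots,\overline{z}_{k-1})$ such that for every finite set $B$ of $\mathrm{lg}(\overline{y})$-tuples with $|B|\ge 2$ and every $p\in S_\varphi(B)$ there are $\overline{c}_0,\dots,\overline{c}_{k-1}\in B$ such that $\psi(\overline{y};\overline{c}_0,\dots,\overline{c}_{k-1})$ defines $p$. A theory has UDTFS if every partitioned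 formula has UDTFS. *)

(* Defs.v *)
From mathcomp Require Import all_boot.
From mathcomp Require Import boolp classical_sets functions cardinality.

Set Implicit Arguments.
Unset Strict Implicit.
Unset Printing Implicit Defensive.

Local Open Scope classical_set_scope.
Local Open Scope card_scope.

Record language := Language {
  fun_sym : Type;
  fun_ar : fun_sym -> nat;
  rel_sym : Type;
  rel_ar : rel_sym -> nat }.

(* [term L V] and [formula L V] have their free variables in V. A quantifier
   binds the variable [None] of [option V]. A tuple of variables is a finite
   index type and a partition of the variables is a sum type: a partitioned
   formula phi(x_0..x_(n-1); y_0..y_(m-1)) is a [formula L ('I_n + 'I_m)]. *)
Inductive term (L : language) (V : Type) : Type :=
| Var of V
| App (f : fun_sym L) of ('I_(fun_ar f) -> term L V).

Inductive formula (L : language) (V : Type) : Type :=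
| Falsum
| Equal of term L V & term L V
| Rel (r : rel_sym L) of ('I_(rel_ar r) -> term L V)
| Imp of formula L V & formula L V
| All of formula L (option V).

Arguments Var {L V}.
Arguments App {L V}.
Arguments Falsum {L V}.
Arguments Equal {L V}.
Arguments Rel {L V}.
Arguments Imp {L V}.
Arguments All {L V}.

Definition Neg L V (A : formula L V) : formula L V := Imp A Falsum.

Fixpoint rename_term L V W (s : V -> W) (t : term L V) : term L W :=
  match t with
  | Var v => Var (s v)
  | App f u => App f (fun i => rename_term s (u i))
  end.

Fixpoint rename L V W (s : V -> W) (A : formula L V) : formula L W :=
  match A with
  | Falsum => Falsum
  | Equal t u => Equal (rename_term s t) (rename_term s u)
  | Rel r t => Rel r (fun i => rename_term s (t i))
  | Imp A1 A2 => Imp (rename s A1) (rename s A2)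
  | All A1 => All (rename (omap s) A1)
  end.

Record structure (L : language) := Structure {
  carrier :> Type;
  carrier_inhabited : inhabited carrier;
  fun_interp : forall f : fun_sym L, ('I_(fun_ar f) -> carrier) -> carrier;
  rel_interp : forall r : rel_sym L, ('I_(rel_ar r) -> carrier) -> Prop }.

Fixpoint eval L (M : structure L) V (e : V -> M) (t : term L V) : M :=
  match t with
  | Var v => e v
  | App f u => fun_interp (fun i => eval e (u i))
  end.

Definition extend V (M : Type) (e : V -> M) (a : M) : option V -> M :=
  fun o => if o is Some v then e v else a.

Fixpoint sat L (M : structure L) V (e : V -> M) (A : formula L V) : Prop :=
  match A with
  | Falsum => False
  | Equal t u => eval e t = eval e u
  | Rel r t => rel_interp (fun i => eval e (t i))
  | Imp A1 A2 => sat e A1 -> sat e A2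
  | All A1 => forall a : M, sat (extend e a) A1
  end.

Definition sentence L := formula L void.

Definition true_in L (M : structure L) (S : sentence L) : Prop :=
  sat (of_void M) S.

Definition theory L := set (sentence L).

Definition models L (M : structure L) (T : theory L) : Prop :=
  forall S, T S -> true_in M S.

Definition entails L (T : theory L) (S : sentence L) : Prop :=
  forall M : structure L, models M T -> true_in M S.

Definition complete_theory L (T : theory L) : Prop :=
  (exists M : structure L, models M T) /\
  forall S : sentence L, entails T S \/ entails T (Neg S).

(* Formulas with parameters: [pformula M X] is the type of L(M)-formulas with
   free variables in X; the variable [inr a] stands for the parameter a. *)
Definition pformula L (M : structure L) (X : Type) := formula L (X + M).

Definition pval (M X : Type) (a : X -> M) (v : X + M) : M :=
  match v with inl x => a x | inr b => b end.

(* M |= theta(a), for an L(M)-formula theta(x) *)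
Definition psat L (M : structure L) X (a : X -> M) (A : pformula M X) : Prop :=
  sat (pval a) A.

Definition inst_var (M X Y : Type) (b : Y -> M) (v : X + Y) : X + M :=
  match v with inl x => inl x | inr y => inr (b y) end.

(* the L(M)-formula phi(x; b) obtained from the L-formula phi(x; y) *)
Definition inst L (M : structure L) X Y (A : formula L (X + Y)) (b : Y -> M) :
    pformula M X :=
  rename (inst_var b) A.

Definition over L (M : structure L) X (D : set M) (A : pformula M X) : Prop :=
  exists A' : formula L (X + D), A = inst A' (fun d : D => val d).

(* Consistency of a set of L(M)-formulas in the variables X is relative to the
   elementary diagram of M, i.e. it is finite satisfiability in M. *)
Definition consistent L (M : structure L) X (p : set (pformula M X)) : Prop :=
  forall F : set (pformula M X), finite_set F -> F `<=` p ->
    exists a : X -> M, forall A, F A -> psat a A.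

Definition realized L (M : structure L) X (p : set (pformula M X)) : Prop :=
  exists a : X -> M, forall A, p A -> psat a A.

(* |D| < |K| *)
Definition card_lt T U (D : set T) (K : set U) : Prop := ~ (K #<= D).

Definition saturated L (K : Type) (M : structure L) : Prop :=
  forall D : set M, card_lt D [set: K] ->
  forall p : set (pformula M 'I_1), p `<=` over D -> consistent p ->
    realized p.

Definition automorphism L (M : structure L) (g : M -> M) : Prop :=
  [/\ bijective g,
      forall (f : fun_sym L) (a : 'I_(fun_ar f) -> M),
        g (fun_interp a) = fun_interp (fun i => g (a i)) &
      forall (r : rel_sym L) (a : 'I_(rel_ar r) -> M),
        rel_interp a <-> rel_interp (fun i => g (a i))].

(* f : D -> M is a partial elementary map of M; the elements of D are used as
   the variables *)
Definition elementary_map L (M : structure L) (D : set M) (f : D -> M) : Prop :=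
  forall A : formula L D, sat (fun d : D => val d : M) A <-> sat f A.

Definition strongly_homogeneous L (K : Type) (M : structure L) : Prop :=
  forall D : set M, card_lt D [set: K] ->
  forall f : D -> M, elementary_map f ->
    exists g : M -> M, automorphism g /\ forall d : D, g (val d) = f d.

(* A model of T that is kappa-saturated and strongly kappa-homogeneous for some
   kappa = |K| greater than |L| + aleph_0 *)
Definition monster_model L (T : theory L) (M : structure L) : Prop :=
  models M T /\
  exists K : Type,
    [/\ card_lt [set: fun_sym L + rel_sym L + nat] [set: K],
        saturated K M &
        strongly_homogeneous K M].

Definition ict_type L (M : structure L) m1 m2
    (phi : formula L ('I_1 + 'I_m1)) (psi : formula L ('I_1 + 'I_m2))
    (b : nat -> 'I_m1 -> M) (c : nat -> 'I_m2 -> M) (l k : nat) :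
    set (pformula M 'I_1) :=
  [set inst phi (b l); inst psi (c k)]
  `|` [set Neg (inst phi (b i)) | i in [set i | i <> l]]
  `|` [set Neg (inst psi (c j)) | j in [set j | j <> k]].

Definition ict_pattern L (M : structure L) m1 m2
    (phi : formula L ('I_1 + 'I_m1)) (psi : formula L ('I_1 + 'I_m2))
    (b : nat -> 'I_m1 -> M) (c : nat -> 'I_m2 -> M) : Prop :=
  forall l k : nat, consistent (ict_type phi psi b c l k).

(* [dp_minimal C] and [has_UDTFS C] express properties of a theory, evaluated
   in a monster model C of it. *)
Definition dp_minimal L (C : structure L) : Prop :=
  ~ exists (m1 m2 : nat)
      (phi : formula L ('I_1 + 'I_m1)) (psi : formula L ('I_1 + 'I_m2))
      (b : nat -> 'I_m1 -> C) (c : nat -> 'I_m2 -> C),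
      ict_pattern phi psi b c.

Definition phi_formulas L (M : structure L) n m (phi : formula L ('I_n + 'I_m))
    (B : set ('I_m -> M)) : set (pformula M 'I_n) :=
  [set inst phi b | b in B] `|` [set Neg (inst phi b) | b in B].

(* S_phi(B) *)
Definition phi_types L (M : structure L) n m (phi : formula L ('I_n + 'I_m))
    (B : set ('I_m -> M)) : set (set (pformula M 'I_n)) :=
  [set p | [/\ p `<=` phi_formulas phi B, consistent p &
     forall q : set (pformula M 'I_n),
       q `<=` phi_formulas phi B -> consistent q -> p `<=` q -> q = p]].

Definition defines L (M : structure L) n m (phi : formula L ('I_n + 'I_m))
    (B : set ('I_m -> M)) (theta : pformula M 'I_m)
    (p : set (pformula M 'I_n)) : Prop :=
  forall b, B b -> (psat b theta <-> p (inst phi b)).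

(* The variables (z_0, .., z_(k-1)) of psi are indexed by 'I_k * 'I_m, with
   (i, j) the j-th coordinate of z_i. *)
Definition formula_UDTFS L (C : structure L) n m
    (phi : formula L ('I_n + 'I_m)) : Prop :=
  exists (k : nat) (psi : formula L ('I_m + 'I_k * 'I_m)),
    forall B : set ('I_m -> C), finite_set B -> `I_2 #<= B ->
    forall p, phi_types phi B p ->
      exists c : 'I_k -> 'I_m -> C,
        (forall i, B (c i)) /\
        defines phi B (inst psi (fun ij => c ij.1 ij.2)) p.

Definition has_UDTFS L (C : structure L) : Prop :=
  forall (n m : nat) (phi : formula L ('I_n + 'I_m)), formula_UDTFS C phi.

(* Main.v *)
(** Fix a finite set [B] and a point [a], and put
    [D b = {x | phi(x,b) differs from phi(a,b)}].  By induction on the number of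
    variables it is enough to treat a single variable [x].

    If every weight on the [phi]-types over [B] other than that of [a] gives
    weight at least [1/2N] to some [D b], then multiplicative weights yield a
    fractional cover of these types by the [D b], the epsilon-net theorem turns
    it into a cover of bounded size, and the literals true of [a] at this cover
    imply its whole [phi]-type.

    Otherwise, for some weight, a greedy choice gives [c_0, .., c_(N-1)] in [B]
    such that no [D b] covers more than a few of the sets
    [E_i = D c_i \ (D c_0 u .. u D c_(i-1))].  If every [b] meets only a minority
    of the [E_i], then the majority of the [E_i] decides [phi(x,b)] correctly,
    which is a uniform definition.  If not, remove from the [E_i] a [D d] meeting
    many of them and repeat.  After boundedly many repetitions the [c_i] and the
    [d_j] form a half grid, and a Ramsey argument extracts a large ICT pattern
    for the formula [phi(x,y) xor phi(x,y')] in both coordinates; by saturation,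
    dp-minimality bounds the size of such patterns. *)

Require Import Defs.
From mathcomp Require Import all_boot zify.
From mathcomp Require boolp.

Set Implicit Arguments.
Unset Strict Implicit.
Unset Printing Implicit Defensive.

(** * Shattering and epsilon-nets *)

Section Shattering.

Variable T : finType.
Implicit Types (F G : {set {set T}}) (A S : {set T}).

Definition shatters F A : bool :=
  [forall W : {set T}, (W \subset A) ==> [exists S in F, S :&: A == W]].

Lemma shattersP F A :
  reflect (forall W : {set T}, W \subset A -> exists2 S, S \in F & S :&: A = W)
          (shatters F A).
Proof.
apply: (iffP forallP) => [h W WA|h W].
  have /implyP/(_ WA)/existsP[S /andP[SF /eqP SA]] := h W.
  by exists S.
by apply/implyP => /h[S SF SA]; apply/existsP; exists S; rewrite SF SA eqxx.
Qed.

Lemma shatters_sub F G A : F \subset G -> shatters F A -> shatters G A.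
Proof.
move=> FG /shattersP h; apply/shattersP => W /h[S SF SA].
by exists S => //; apply: (subsetP FG).
Qed.

(** Induction on [#|F|]: a point [x] separating two members splits [F] into two smaller families. A
    set shattered by either half avoids [x] and is shattered by [F]; a set [A] shattered by both
    halves also makes [x |: A] shattered by [F]. *)
Lemma pajor F : #|F| <= #|[set A | shatters F A]|.
Proof.
have [n] := ubnP #|F|; elim: n F => // n IH F /ltnSE Fn.
have [F1|F1] := leqP #|F| 1.
  have [->|[S SF]] := set_0Vmem F; first by rewrite cards0.
  apply: leq_trans F1 _; apply/card_gt0P; exists set0; rewrite inE.
  apply/shattersP => W; rewrite subset0 => /eqP ->.
  by exists S => //; rewrite setI0.
have [S1 [S2 [S1F S2F S12]]] : exists S1 S2, [/\ S1 \in F, S2 \in F & S1 != S2].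
  by case/card_gt1P: F1 => S1 [S2 [*]]; exists S1, S2.
wlog [x xS1 xS2] : S1 S2 S1F S2F S12 / exists2 x, x \in S1 & x \notin S2.
  move=> hw; have [/subsetP S1S2|/subsetPn[x ? ?]] := boolP (S1 \subset S2); last first.
    by apply: (hw S1 S2) => //; exists x.
  have [/subsetP S2S1|/subsetPn[x ? ?]] := boolP (S2 \subset S1).
    case/eqP: S12; apply/setP => y; apply/idP/idP; [exact: S1S2|exact: S2S1].
  by apply: (hw S2 S1) => //; [rewrite eq_sym|exists x].
pose F1' := [set S in F | x \in S]; pose F0' := [set S in F | x \notin S].
have cF : #|F| = #|F1'| + #|F0'|.
  rewrite -(cardsID [set S : {set T} | x \in S] F).
  by congr (_ + _); apply: eq_card => S; rewrite !inE andbC // andbC.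
have F1gt : 0 < #|F1'| by apply/card_gt0P; exists S1; rewrite inE S1F.
have F0gt : 0 < #|F0'| by apply/card_gt0P; exists S2; rewrite inE S2F.
have h1 : #|F1'| <= #|[set A | shatters F1' A]| by apply: IH; lia.
have h0 : #|F0'| <= #|[set A | shatters F0' A]| by apply: IH; lia.
set sh1 := [set A | shatters F1' A] in h1; set sh0 := [set A | shatters F0' A] in h0.
have sub1 : F1' \subset F by apply/subsetP => S; rewrite inE => /andP[].
have sub0 : F0' \subset F by apply/subsetP => S; rewrite inE => /andP[].
have nx1 A : A \in sh1 -> x \notin A.
  rewrite inE => /shattersP/(_ set0 (sub0set _))[S]; rewrite inE => /andP[_ xS] SA.
  by apply/negP => xA; have : x \in S :&: A; [rewrite inE xS|rewrite SA inE].
have nx0 A : A \in sh0 -> x \notin A.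
  rewrite inE => /shattersP/(_ A (subxx _))[S]; rewrite inE => /andP[_ xS] SA.
  by apply/negP => xA; move: (xA); rewrite -SA inE (negPf xS).
(* [Q] compensates for the sets counted twice in [#|sh1| + #|sh0|]. *)
pose Q := [set x |: A | A in sh1 :&: sh0].
have cQ : #|Q| = #|sh1 :&: sh0|.
  apply: card_in_imset => A B; rewrite !inE => /andP[sA _] /andP[sB _] e.
  have xA : x \notin A by apply: nx1; rewrite inE.
  have xB : x \notin B by apply: nx1; rewrite inE.
  by rewrite -(setU1K xA) e setU1K.
have dQ : [disjoint sh1 :|: sh0 & Q].
  rewrite -setI_eq0; apply/eqP/setP => A; rewrite !inE.
  apply/negbTE/negP => /andP[sA /imsetP[B _ AB]].
  have xA : x \in A by rewrite AB setU11.
  by case/orP: sA => sA; [have := nx1 A|have := nx0 A]; rewrite inE sA xA => /(_ isT).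
have: #|(sh1 :|: sh0) :|: Q| <= #|[set A | shatters F A]|.
  apply/subset_leq_card/subsetP => A; rewrite !inE => /orP[/orP[]|].
  - exact: shatters_sub.
  - exact: shatters_sub.
  case/imsetP => B; rewrite !inE => /andP[s1 s0] ->{A}.
  have xB : x \notin B by apply: nx1; rewrite inE.
  apply/shattersP => W WB.
  have WxB : W :\ x \subset B.
    apply/subsetP => y; rewrite !inE => /andP[yx /(subsetP WB)].
    by rewrite !inE (negPf yx).
  have [xW|xW] := boolP (x \in W).
    have /shattersP/(_ _ WxB)[S] := s1; rewrite inE => /andP[SF xS] SB.
    exists S => //; apply/setP => y; have /setP/(_ y) := SB; rewrite !inE.
    by have [->|yx] := eqVneq y x; rewrite ?xS ?xW //=.
  have /shattersP/(_ _ WxB)[S] := s0; rewrite inE => /andP[SF xS] SB.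
  exists S => //; apply/setP => y; have /setP/(_ y) := SB; rewrite !inE.
  by have [->|yx] := eqVneq y x; rewrite ?(negPf xS) ?(negPf xW) //=.
have := cardsUI sh1 sh0.
move: (leq_card_setU (sh1 :|: sh0) Q) => [_]; rewrite dQ => /eqP ->.
rewrite cQ; lia.
Qed.

(** A small set is coded by a [d]-tuple in [option T], with [None] as padding. *)
Lemma card_small_sets d :
  #|[set A : {set T} | #|A| < d]| <= #|T|.+1 ^ d.
Proof.
pose f (u : {ffun 'I_d -> option T}) : {set T} := [set x | [exists i, u i == Some x]].
have -> : #|T|.+1 ^ d = #|{: {ffun 'I_d ->
  option T}}| by rewrite card_ffun card_ord card_option.
rewrite -cardsT; apply: leq_trans (leq_imset_card f _).
apply/subset_leq_card/subsetP => A; rewrite inE => Ad.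
apply/imsetP; exists [ffun i : 'I_d => nth None (map Some (enum A)) i] => //.
apply/setP => x; rewrite inE; apply/idP/existsP => [xA|[i]].
  have xi : index x (enum A) < #|A| by rewrite cardE index_mem mem_enum.
  exists (Ordinal (ltn_trans xi Ad)); rewrite ffunE /= (nth_map x) -?cardE //.
  by rewrite nth_index ?mem_enum.
rewrite ffunE; have [iA|iA] := ltnP i (size (enum A)).
  by rewrite (nth_map x) // => /eqP[<-]; rewrite -mem_enum mem_nth.
by rewrite nth_default // size_map.
Qed.

Lemma sauer F d : (forall A, shatters F A -> #|A| < d) -> #|F| <= #|T|.+1 ^ d.
Proof.
move=> h; apply: leq_trans (pajor F) _; apply: leq_trans (card_small_sets d).
by apply/subset_leq_card/subsetP => A; rewrite !inE; apply: h.
Qed.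

End Shattering.

Lemma leq_expn2r m n e : m <= n -> m ^ e <= n ^ e.
Proof. by case: e => // e mn; rewrite leq_exp2r. Qed.

(** Serves to choose a hit threshold [h] at which a polynomial number of traces loses against
    [2 ^ h]. *)
Lemma pow2_gt_poly a q d : exists h, q * (a * h).+1 ^ d < 2 ^ h.
Proof.
(* For [h = 2 ^ n] the left side is below [2 ^ (q + (a + n) * d)], and [n = 2 * c] gives
   [2 ^ n >= (c + 1) ^ 2], which is at least that exponent. *)
pose c := q + a + 2 * d; pose n := 2 * c.
exists (2 ^ n).
have c1 : c.+1 <= 2 ^ c by apply: ltn_expl.
have an : (a * 2 ^ n).+1 <= 2 ^ (a + n).
  have : a.+1 * 2 ^ n <= 2 ^ a * 2 ^ n by rewrite leq_mul2r ltn_expl ?orbT.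
  by rewrite expnD; have := expn_gt0 2 n; lia.
have : q + (a + n) * d <= 2 ^ n.
  by rewrite /n mul2n -addnn expnD; apply: leq_trans (leq_mul c1 c1); rewrite /c; nia.
move=> /(leq_pexp2l (isT : 0 < 2)); apply: leq_trans.
rewrite expnD mulnC (mulnC (2 ^ q)) expnM.
apply: leq_ltn_trans (_ : (2 ^ (a + n)) ^ d * q < _).
  by rewrite leq_mul2r leq_expn2r ?orbT.
by rewrite ltn_pmul2l ?expn_gt0 // ltn_expl.
Qed.

(** * Fractional covers by multiplicative weights *)

Section Net.

Variables (J : finType).
Implicit Types (F X : {set {set J}}).

(** Two terms of the binomial expansion suffice. For [n.+1 = 2 * q], a product of [2 * q] factors
    [1 - 1/(2q)] is at most 1/2. *)
Lemma bernoulli_half n : 2 * n ^ n.+1 <= n.+1 ^ n.+1.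
Proof.
have h k : n ^ k.+1 + k.+1 * n ^ k <= n.+1 ^ k.+1.
  elim: k => [|k IH]; first by rewrite !expn1 expn0; lia.
  rewrite [n.+1 ^ k.+2]expnS; apply: leq_trans (leq_mul (leqnn n.+1) IH).
  rewrite (expnS n k.+1) (expnS n k); nia.
have := h n; rewrite (expnS n n); lia.
Qed.

(** Each round doubles the weight of the sets missed by the chosen [j], while the hypothesis lets
    the total grow by a factor of at most [2 - 1/q]; a set hit too rarely would outweigh the total.
    The clause [0 < size z] excludes the empty sequence, for which the inequalities are trivial. *)
Lemma fractional_cover X q :
  0 < q ->
  (forall w : {set J} -> nat,
     exists j, \sum_(S in X) w S <= q * \sum_(S in X | j \in S) w S) ->
  exists z : seq J, (0 < size z \/ X = set0) /\
    forall S, S \in X -> size z <= 4 * q * count [in S] z.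
Proof.
move=> q0 hw.
have [->|[S0 S0X]] := set_0Vmem X.
  by exists [::]; split; [right|move=> S; rewrite inE].
have X0 : 0 < #|X| by apply/card_gt0P; exists S0.
have Wt t : exists2 z : seq J, size z = t &
    q ^ t * \sum_(S in X) 2 ^ count [predC S] z <= (2 * q).-1 ^ t * #|X|.
  elim: t => [|t [z zt IH]].
    by exists [::] => //=; rewrite !expn0 !mul1n sum1_card.
  have [j hj] := hw (fun S => 2 ^ count [predC S] z).
  exists (j :: z); first by rewrite /= zt.
  set W := \sum_(S in X) _ in IH hj; set V := \sum_(S in X | _) _ in hj.
  have -> : \sum_(S in X) 2 ^ count [predC S] (j :: z) = 2 * W - V.
    have VW : V <= W by rewrite /W (bigID (fun S : {set J} => j \in S)) /= leq_addr.
    suff : \sum_(S in X) 2 ^ count [predC S] (j :: z) + V = 2 * W by lia.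
    rewrite /W /V big_mkcondr -big_split big_distrr /=; apply: eq_bigr => S _.
    by case: (j \in S); rewrite /= ?expnD ?expn1 ?expn0; lia.
  rewrite !expnS -mulnA [_ * (2 * W - V)]mulnC mulnA;
    apply: leq_trans (_ : (2 * q).-1 * (q ^ t * W) <= _);
      last by rewrite -mulnA leq_pmul2l //; lia.
  have : q * (2 * W - V) <= (2 * q).-1 * W by nia.
  by move=> h; rewrite [q ^ t * W]mulnC mulnA leq_pmul2r // expn_gt0 q0.
(* These rounds form [2 * s] blocks of [2 * q], each gaining a factor 2 by [bernoulli_half]; as
   [s < 2 ^ s], more than [s] rounds hit any given [S]. *)
pose s := #|X|; have [z zs hz] := Wt (4 * q * s).
exists z; split; first by left; rewrite zs /s; lia.
move=> S SX; rewrite zs leq_pmul2l; last by lia.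
have h1 : q ^ (4 * q * s) * 2 ^ count [predC S] z <= (2 * q).-1 ^ (4 * q * s) * #|X|.
  apply: leq_trans hz; rewrite leq_pmul2l ?expn_gt0 ?q0 //.
  by rewrite (bigD1 S) //= leq_addr.
have e : (2 * q) ^ (4 * q * s) = q ^ (4 * q * s) * 2 ^ count [predC S] z * 2 ^ count
  [in S] z.
  by rewrite -(mulnA (q ^ _)) -expnD addnC (count_predC (mem S)) zs expnMn mulnC.
have h2 : (2 * q) ^ (4 * q * s) <= (2 * q).-1 ^ (4 * q * s) * (#|X| * 2 ^ count [in S] z).
  by rewrite e mulnA leq_mul2r h1 orbT.
have h3 : 2 ^ (2 * s) * (2 * q).-1 ^ (4 * q * s) <= (2 * q) ^ (4 * q * s).
  have -> : 4 * q * s = (2 * q).-1.+1 * (2 * s) by rewrite prednK; lia.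
  rewrite !(expnM _ _ (2 * s)) -!expnMn; apply: leq_expn2r.
  by have := bernoulli_half (2 * q).-1; rewrite prednK //; lia.
have h4 : 2 ^ (2 * s) <= #|X| * 2 ^ count [in S] z.
  have := leq_trans h3 h2; rewrite mulnC leq_pmul2l // expn_gt0.
  by apply/orP; left; lia.
have h5 : 2 ^ (2 * s) < 2 ^ (s + count [in S] z).
  by apply: leq_ltn_trans h4 _; rewrite expnD ltn_pmul2r ?expn_gt0 // ltn_expl.
by move: h5; rewrite ltn_exp2l //; lia.
Qed.

End Net.

(** Cutting out singletons forces [f] to be injective on [A]. Bounds on shattered sets thus pass to
    samples and to sequences with repetitions. *)
Lemma shatters_preim (T U : finType) (f : T -> U) (F : {set {set U}}) (A : {set T}) :
  shatters [set f @^-1: (S : {set U}) | S in F] A ->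
    shatters F (f @: A) /\ #|f @: A| = #|A|.
Proof.
move=> /shattersP sh; split.
  apply/shattersP => V VA.
  have VA' : f @^-1: V :&: A \subset A by apply: subsetIr.
  have [_ /imsetP[S SF ->] e] := sh _ VA'.
  exists S => //; apply/setP => y; rewrite inE.
  apply/andP/idP => [[yS /imsetP[x xA yx]]|yV].
    by have /setP/(_ x) := e; rewrite !inE -yx yS xA /= andbT => <-.
  have /imsetP[x xA yx] := subsetP VA _ yV.
  have /setP/(_ x) := e; rewrite !inE -yx yV xA /= andbT => ->.
  by split => //; rewrite yx imset_f.
apply: card_in_imset => x x' xA x'A fxx'.
have xA' : [set x] \subset A by rewrite sub1set.
have [_ /imsetP[S SF ->] e] := sh _ xA'.
have /setP/(_ x) := e; have /setP/(_ x') := e; rewrite !inE eqxx xA x'A fxx' !andbT.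
by move=> + h; rewrite h => /esym/eqP.
Qed.

(** * The epsilon-net theorem for uniform weights *)

Section UniformNet.

Variables (A : finType) (X : {set {set A}}) (m h : nat).
Let Y := {ffun 'I_m -> A}.

Lemma card_ffun_coord (i : 'I_m) (S : {set A}) :
  #|A| * #|[set v : Y | v i \in S]| = #|S| * #|A| ^ m.
Proof.
have -> : #|[set v : Y | v i \in S]| = \sum_(v :
  Y) \prod_k (if k == i then (v k \in S : nat) else 1).
  rewrite -sum1_card big_mkcond; apply: eq_bigr => v _; rewrite inE (bigD1 i) //= eqxx.
  by rewrite big1 ?muln1 => [|k /negPf->] //; case: (v i \in S).
rewrite -(bigA_distr_bigA (fun k x => if k == i then (x \in S : nat) else 1)).
rewrite (bigD1 i) //= eqxx.
have -> : \prod_(k | k != i) \sum_x (if k == i then (x \in S :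
  nat) else 1) = \prod_(k | k != i) #|A|.
  by apply: eq_bigr => k /negPf ki; under eq_bigr do rewrite ki; rewrite sum1_card.
rewrite prod_nat_const cardC1 card_ord.
have -> : \sum_x (x \in S : nat) = #|S| by rewrite -sum1_card [RHS]big_mkcond;
  apply: eq_bigr => x _; case: (x \in S).
have m0 : 0 < m by case: (m) i => [[]|].
by rewrite mulnCA -expnS prednK.
Qed.

(** The average number of hits is at least [m / q = 2 * h] and no sample has more than [m], so a
    fraction at least [h / m = 1/(2q)] of the samples reaches [h]. *)
Lemma many_hits q (S : {set A}) : 0 < h -> 0 < #|A| ->
  m = 2 * q * h -> #|A| <= q * #|S| ->
  #|A| ^ m <= 2 * q * #|[set v : Y | h <= #|[set i | v i \in S]|]|.
Proof.
move=> h0 A0 mE AS; set G := [set v : Y | _].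
have e : #|A| * \sum_(v : Y) #|[set i | v i \in S]| = m * (#|S| * #|A| ^ m).
  have -> : \sum_(v : Y) #|[set i | v i \in S]| = \sum_(i < m) #|[set v : Y | v i \in S]|.
    under eq_bigr do rewrite -sum1_card big_mkcond.
    rewrite exchange_big; apply: eq_bigr => i _; rewrite -sum1_card [RHS]big_mkcond.
    by apply: eq_bigr => v _; rewrite !inE.
  rewrite big_distrr /= (eq_bigr (fun=> #|S| * #|A| ^ m)) => [|i _];
    last exact: card_ffun_coord.
  by rewrite sum_nat_const card_ord.
have le : \sum_(v : Y) #|[set i | v i \in S]| <= m * #|G| + h * #|A| ^ m.
  rewrite (bigID (fun v => v \in G)) /=; apply: leq_add.
    rewrite mulnC -sum_nat_const; apply: leq_sum => v _.
    by apply: leq_trans (max_card _) _; rewrite card_ord.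
  have -> : #|A| ^ m = #|Y| by rewrite card_ffun card_ord.
  rewrite mulnC -sum_nat_const big_mkcond; apply: leq_sum => v _.
  by case: ifP => //; rewrite inE -ltnNge => /ltnW.
have : m * (#|S| * #|A| ^ m) <= #|A| * (m * #|G| + h * #|A| ^ m) by rewrite -e
  leq_mul2l le orbT.
set a := #|A| in A0 AS *; set P := _ ^ m; set g := #|G|; set t := #|S| in AS *.
rewrite mE => H.
have H2 : 2 * h * (q * t) * P <= a * (2 * q * h * g + h * P) by lia.
have H3 : 2 * h * a * P <= 2 * h * (q * t) * P by rewrite leq_mul2r leq_mul2l AS !orbT.
have H4 : (a * h) * (2 * P) <= (a * h) * (2 * q * g + P) by lia.
by move: H4; rewrite leq_pmul2l; [lia|rewrite muln_gt0 A0].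
Qed.

Definition bad_pair (u v : Y) :=
  [exists S in X, [forall i, u i \notin S] && (h <= #|[set i | v i \in S]|)].

Definition swap_pair (s : {ffun 'I_m -> bool}) (uv : Y * Y) : Y * Y :=
  ([ffun i => if s i then uv.2 i else uv.1 i], [ffun i => if s i then uv.1 i else uv.2 i]).

Lemma swap_pairK s : involutive (swap_pair s).
Proof.
case=> u v; congr pair; apply/ffunP => i; rewrite !ffunE /=; by case: (s i).
Qed.

(** [W] is the trace of a set on the double sample, indexed by coordinate and sample ([false] for
    [u], [true] for [v]). *)
Definition good_swap (W : {set 'I_m * bool}) (s : {ffun 'I_m -> bool}) :=
  [forall i, (i, s i) \notin W] && (h <= #|[set i | (i, ~~ s i) \in W]|).

(** Fix one good exchange [t]. At the [h] or more coordinates where [t] puts a point of [W] in the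
    second sample, every good exchange must agree with [t]. *)
Lemma few_good_swaps W : #|[set s | good_swap W s]| * 2 ^ h <= 2 ^ m.
Proof.
have [->|[t]] := set_0Vmem [set s | good_swap W s]; first by rewrite cards0.
rewrite inE => /andP[/forallP t1 t2].
pose I := [set i | (i, ~~ t i) \in W].
have agree s : good_swap W s -> forall i, i \in I -> s i = t i.
  move=> /andP[/forallP s1 _] i; rewrite inE => iW.
  by have := s1 i; case: (s i) (t i) iW => [] [] //= ->.
have -> : 2 ^ m = (\prod_(i < m) (if i \in I then 1 else 2)) * 2 ^ #|I|.
  rewrite -[2 ^ #|I|]prod_nat_const [X in _ * X]big_mkcond -big_split /=.
  by rewrite -[m in LHS]card_ord -prod_nat_const; apply: eq_bigr => i _; case: ifP.
apply: leq_mul; last by rewrite leq_exp2l.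
have -> : \prod_(i < m) (if i \in I then 1 else 2) =
    \prod_(i < m) \sum_(b : bool) (((i \in I) ==> (b == t i)) : nat).
  by apply: eq_bigr => i _; rewrite big_bool; case: (i \in I); case: (t i).
rewrite bigA_distr_bigA -sum1_card big_mkcond; apply: leq_sum => s _.
rewrite inE; case: ifP => // gs; rewrite big1 // => i _.
by case: (boolP (i \in I)) => //= iI; rewrite (agree s gs i iI) eqxx.
Qed.

(* Double sampling: averaging over the 2 ^ m exchanges of coordinates of u and v,
   each of the polynomially many traces is bad for at most 2 ^ (m - h) of them. *)
Lemma few_bad_pairs d : (forall W, shatters X W -> #|W| < d) ->
  2 ^ h * #|[set uv : Y * Y | bad_pair uv.1 uv.2]| <= (2 * m).+1 ^ d * (#|A| ^ m * #|A|
    ^ m).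
Proof.
move=> vc; set N := #|_|.
have mm : #|{ffun 'I_m -> bool}| = 2 ^ m by rewrite card_ffun card_bool card_ord.
suff H : 2 ^ m * (2 ^ h * N) <= 2 ^ m * ((2 * m).+1 ^ d * (#|A| ^ m * #|A| ^ m)).
  by move: H; rewrite leq_pmul2l ?expn_gt0.
have NE : N = \sum_(uv : Y * Y) (bad_pair uv.1 uv.2 : nat).
  by rewrite /N -sum1_card big_mkcond; apply: eq_bigr => uv _; rewrite inE;
    case: (bad_pair _ _).
(* Each exchange permutes the pairs, so bad pairs may be counted after exchanging, pair by pair. *)
have -> : 2 ^ m * (2 ^ h * N) = 2 ^ h * \sum_(uv :
  Y * Y) #|[set s | bad_pair (swap_pair s uv).1 (swap_pair s uv).2]|.
  rewrite mulnCA; congr (_ * _); rewrite -mm -sum_nat_const.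
  under [RHS]eq_bigr do rewrite -sum1_card big_mkcond.
  rewrite exchange_big /=; apply: eq_big => // s _;
    rewrite NE (reindex_inj (inv_inj (swap_pairK s))).
  by apply: eq_bigr => uv _; rewrite !inE; case: (bad_pair _ _).
rewrite big_distrr /=.
have -> : 2 ^ m * ((2 * m).+1 ^ d * (#|A| ^ m * #|A| ^ m)) =
    \sum_(uv : Y * Y) (2 * m).+1 ^ d * 2 ^ m.
  rewrite sum_nat_const card_prod card_ffun card_ord; lia.
apply: leq_sum => -[u v] _.
pose f (p : 'I_m * bool) := if p.2 then v p.1 else u p.1.
pose TT := [set f @^-1: (S : {set _}) | S in X].
have TTd : #|TT| <= (2 * m).+1 ^ d.
  have -> : 2 * m = #|{: 'I_m * bool}| by rewrite card_prod card_ord card_bool mulnC.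
  by apply: sauer => W /shatters_preim[/vc + <-].
apply: leq_trans (_ : \sum_(W in TT) 2 ^ m <= _);
  last by rewrite sum_nat_const leq_mul2r TTd orbT.
apply: leq_trans (_ : \sum_(W in TT) (#|[set s | good_swap W s]| * 2 ^ h) <= _); last first.
  by apply: leq_sum => W _; apply: few_good_swaps.
rewrite -big_distrl /= mulnC leq_mul2r; apply/orP; right.
apply: leq_trans (_ : #|\bigcup_(W in TT) [set s | good_swap W s]| <= _).
  apply/subset_leq_card/subsetP => s; rewrite inE => /existsP[S /and3P[SX /forallP S1 S2]].
  apply/bigcupP; exists (f @^-1: S); first exact: imset_f.
  rewrite inE; apply/andP; split.
    by apply/forallP => i; have := S1 i; rewrite !inE ffunE /f /=.
  apply: leq_trans S2 _; apply/subset_leq_card/subsetP => i.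
  by rewrite !inE ffunE /f /= if_neg.
elim/big_rec2: _ => [|W n U _ IH]; first by rewrite cards0.
by apply: leq_trans (leq_card_setU _ _) _; rewrite leq_add2l.
Qed.

End UniformNet.

(** If no [m]-tuple works, each [u] misses some [S] that a fraction 1/(2q) of the [v] hit [h] times;
    this yields more bad pairs than [few_bad_pairs] allows. *)
Lemma uniform_net d q : exists m, forall (A : finType) (X : {set {set A}}),
  0 < #|A| -> (forall W, shatters X W -> #|W| < d) ->
  (forall S, S \in X -> #|A| <= q * #|S|) ->
  exists y : {ffun 'I_m -> A}, forall S, S \in X -> exists i, y i \in S.
Proof.
have [h hh] := pow2_gt_poly (4 * q) (2 * q) d.
(* [h = 0] forces [q = 0], and then [X] is empty. *)
have [h0|h0] := posnP h.
  exists 0 => A X A0 vc hX.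
  move: hh; rewrite h0 muln0 exp1n muln1 expn0 => q0.
  have [a _] := card_gt0P A0; exists [ffun=> a] => S /hX; lia.
exists (2 * q * h) => A X A0 vc hX; set m := 2 * q * h.
have [/existsP[y /forallP hy]|no] :=
  boolP [exists y : {ffun 'I_m -> A}, [forall S in X, [exists i, y i \in S]]].
  by exists y => S SX; have /implyP/(_ SX)/existsP := hy S.
exfalso.
have miss (y : {ffun 'I_m -> A}) : exists2 S, S \in X & forall i, y i \notin S.
  move: no; rewrite negb_exists => /forallP/(_ y); rewrite negb_forall => /existsP[S].
  by rewrite negb_imply negb_exists => /andP[SX /forallP]; exists S.
have := @few_bad_pairs A X m h d vc; set N := #|_| => NU.
have NL : (#|A| ^ m * #|A| ^ m) <= 2 * q * N.
  have -> : N = \sum_(u : {ffun 'I_m -> A}) #|[set v | bad_pair X h u v]|.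
    rewrite /N -sum1_card (eq_bigr (fun u :
      {ffun 'I_m -> A} => \sum_v (bad_pair X h u v : nat))); last first.
      by move=> u _; rewrite -sum1_card big_mkcond; apply: eq_bigr => v _; rewrite inE;
        case: bad_pair.
    rewrite pair_big big_mkcond; apply: eq_bigr => -[u v] _ /=; rewrite inE /=;
      by case: bad_pair.
  rewrite big_distrr /= -{1}(card_ord m) -card_ffun -sum_nat_const.
  apply: leq_sum => u _; have [S SX uS] := miss u.
  apply: leq_trans (many_hits h0 A0 (erefl _) (hX S SX)) _.
  rewrite leq_mul2l; apply/orP; right; apply/subset_leq_card/subsetP => v;
    rewrite !inE => hv.
  by apply/existsP; exists S; rewrite SX hv andbT; apply/forallP.
have P0 : 0 < #|A| ^ m * #|A| ^ m by rewrite muln_gt0 expn_gt0 A0.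
set P := _ ^ m * _ in NU NL P0.
have N0 : 0 < N by case: (N) NL => //; rewrite muln0; lia.
have : 2 ^ h * N <= (2 * m).+1 ^ d * (2 * q * N) by apply: leq_trans NU _;
  rewrite leq_mul2l NL orbT.
have -> : 2 * m = 4 * q * h by rewrite /m; lia.
rewrite mulnA [X in _ <= X * N]mulnC leq_pmul2r //.
by rewrite leqNgt hh.
Qed.

(** The uniform case applied to the positions of [z]. *)
Lemma epsilon_net d q : exists m, forall (J : finType) (X : {set {set J}}) (z : seq J),
  (forall W, shatters X W -> #|W| < d) -> 0 < size z ->
  (forall S, S \in X -> size z <= q * count [in S] z) ->
  exists y : {ffun 'I_m -> J}, forall S, S \in X -> exists i, y i \in S.
Proof.
have [m hm] := uniform_net d q; exists m => J X z vc z0 hz.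
pose f (i : 'I_(size z)) := tnth (in_tuple z) i.
have [|W /shatters_preim[/vc + <-]|_ /imsetP[S SX ->]|y hy] :=
  hm 'I_(size z) [set f @^-1: (S : {set _}) | S in X].
- by rewrite card_ord.
- by [].
- rewrite card_ord (leq_trans (hz S SX)) // leq_mul2l; apply/orP; right.
  have zE : [seq f i | i <- enum 'I_(size z)] = z by apply: map_tnth_enum.
  have -> : count [in S] z = count [in S] [seq f i | i <- enum 'I_(size z)] by rewrite zE.
  rewrite count_map -sum1_count big_enum_cond /= -sum1_card; apply: eq_leq;
    apply: eq_bigl => i.
  by rewrite !inE.
exists [ffun i => f (y i)] => S SX.
have [|i] := hy (f @^-1: S); first exact: imset_f.
by rewrite inE => hi; exists i; rewrite ffunE.
Qed.

(** * Greedy windows and grids *)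

(** Dual view: elements of [J] stand for parameters, and a set [S] stands for a type, given by the
    parameters where it differs from the type of [a]. Thus [first_hit c i] is the set [E_i]. *)
Definition first_hit (J : finType) (c : nat -> J) (i : nat) (S : {set J}) :=
  (c i \in S) && [forall k : 'I_i, c k \notin S].

Lemma first_hitP (J : finType) (c : nat -> J) i (S : {set J}) :
  reflect (c i \in S /\ forall k, k < i -> c k \notin S) (first_hit c i S).
Proof.
apply: (iffP andP) => -[ci h]; split => //.
  by move=> k ki; have /forallP/(_ (Ordinal ki)) := h.
by apply/forallP => k; apply: h.
Qed.

Section Greedy.

Variables (J : finType) (j0 : J) (w : {set J} -> nat).
Implicit Types (A X : {set {set J}}).

Let wt A := \sum_(S in A) w S.
Let hits A j := [set S in A | j \in S].
Let best A := [arg max_(j > j0) wt (hits A j)].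
Let gain A := wt (hits A (best A)).
Let greedy A i := iter i (fun X => X :\: hits X (best X)) A.

Let wtS A X : A \subset X -> wt A <= wt X.
Proof. by move=> AX; rewrite /wt [leqRHS](big_setID A) /= (setIidPr AX) leq_addr. Qed.

Let le_gain A j : wt (hits A j) <= gain A.
Proof. by rewrite /gain /best; case: arg_maxnP => // k _; apply. Qed.

Let gainS A X : A \subset X -> gain A <= gain X.
Proof.
move=> AX; apply: leq_trans (le_gain X (best A)).
apply/wtS/subsetP => S; rewrite !inE => /andP[SA ->].
by rewrite (subsetP AX).
Qed.

Let greedyP A i S :
  (S \in greedy A i) = (S \in A) && [forall k : 'I_i, best (greedy A k) \notin S].
Proof.
elim: i => [|i IH] /=.
  by rewrite (_ : [forall k, _]) ?andbT //; apply/forallP => -[].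
rewrite !inE -/(greedy A i) IH; apply/andP/andP.
  move=> [h /andP[SA /forallP hS]]; split => //; apply/forallP => k.
  have [ki|ki] := ltnP k i; first exact: (hS (Ordinal ki)).
  have -> : k = i :> nat by have := ltn_ord k; lia.
  by move: h; rewrite SA /= (_ : [forall _, _]) //; apply/forallP.
move=> [SA /forallP hS]; split.
  by rewrite negb_and (hS ord_max) orbT.
by rewrite SA; apply/forallP => k; apply: (hS (widen_ord (leqnSn i) k)).
Qed.

Let greedyS A i k : i <= k -> greedy A k \subset greedy A i.
Proof.
move=> ik; apply/subsetP => S; rewrite !greedyP => /andP[-> /forallP h].
by apply/forallP => l; apply: (h (widen_ord ik l)).
Qed.

Let wt_greedy A i : wt A <= wt (greedy A i) + i * gain A.
Proof.
elim: i => [|i IH]; first by rewrite mul0n addn0.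
apply: leq_trans IH _; rewrite mulSn addnA leq_add2r /wt /=.
rewrite -/(greedy A i) (big_setID (hits (greedy A i) (best (greedy A i)))) /= addnC
  leq_add2l.
rewrite (setIidPr _); last by apply/subsetP => S; rewrite inE => /andP[].
by apply: (leq_trans _ (gainS (greedyS A (leq0n i)))).
Qed.

(* Every N greedy steps either lose at most half of the gain, which is the
   conclusion, or halve it; in the latter case what is left of A still has
   weight greater than 2N times the new gain. *)
Lemma greedy_window N A :
  (forall S, S \in A -> S != set0) ->
  (forall j, 2 * N * \sum_(S in A | j \in S) w S < \sum_(S in A) w S) ->
  exists (A' : {set {set J}}) (e : nat) (c : nat -> J),
    [/\ A' \subset A, 0 < e,
        forall j, \sum_(S in A' | j \in S) w S <= e &
        forall i, i < N -> e <= 2 * \sum_(S in A' | first_hit c i S) w S].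
Proof.
have hitsE X j : wt (hits X j) = \sum_(S in X | j \in S) w S.
  by apply: eq_bigl => S; rewrite inE.
move=> A0 hA; have : 2 * N * gain A < wt A by rewrite /gain hitsE; apply: hA.
clear hA.
have [n] := ubnP (gain A); elim: n A A0 => // n IH A A0 /ltnSE An hA.
have [le|lt] := leqP (gain A) (2 * gain (greedy A N)); last first.
  have [|||A' [e [c [A'S e0 h1 h2]]]] := IH (greedy A N).
  - by move=> S /(subsetP (greedyS A (leq0n N))); apply: A0.
  - by lia.
  - by have := wt_greedy A N; nia.
  by exists A', e, c; split => //; apply: subset_trans A'S (greedyS A (leq0n N)).
exists A, (gain A), (fun k => best (greedy A k)); split => //.
- have /card_gt0P[S] : 0 < #|[set S in A | 0 < w S]|.
    rewrite card_gt0; apply/negP => /eqP/setP A00; move: hA; rewrite /wt big1; first by lia.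
    by move=> S SA; have := A00 S; rewrite !inE SA /=; case: (w S).
  rewrite inE => /andP[SA wS]; have [j jS] := set0Pn _ (A0 S SA).
  apply: leq_trans wS _; apply: leq_trans (le_gain A j).
  by rewrite hitsE (bigD1 S) ?SA //= leq_addr.
- by move=> j; rewrite -hitsE.
(* The gain only decreases along the greedy run, and the gain at stage [i] is exactly the weight of
   the sets first hit by [c i]. *)
move=> i iN; apply: leq_trans le _; rewrite leq_mul2l /=.
apply: leq_trans (gainS (greedyS A (ltnW iN))) _.
rewrite /gain hitsE; apply: eq_leq; apply: eq_bigl => S.
by rewrite greedyP /first_hit -andbA; congr (_ && _); rewrite andbC.
Qed.

End Greedy.

(** Keep the head [x], pass to a largest colour class of [f x] on the tail by the pigeonhole
    principle, and recurse. *)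
Lemma end_homogeneous (C : finType) k : exists n, forall (f : nat -> nat -> C) (s :
  seq nat),
  n <= size s -> exists t,
    [/\ subseq t s, size t = k & forall i j j', i < j < k -> i < j' < k ->
      f (nth 0 t i) (nth 0 t j) = f (nth 0 t i) (nth 0 t j')].
Proof.
elim: k => [|k [n IH]].
  by exists 0 => f s _; exists [::]; split => //; [apply: sub0seq|move=> i j j' /andP[]].
exists (#|C| * n).+1 => f [//|x s] /ltnSE hs.
have [c hc] : exists c, n <= count (fun y => f x y == c) s.
  apply/existsP; rewrite -[X in is_true X]negbK negb_exists; apply/negP => /forallP h.
  have szE : size s = \sum_(c : C) count (fun y => f x y == c) s.
    elim: (s) => [|y s' IHs] /=; first by rewrite big1.
    rewrite big_split /= -IHs (bigD1 (f x y)) //= eqxx big1 ?addn0 // => c.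
    by rewrite eq_sym => /negPf->.
  have C0 : 0 < #|C| by apply/card_gt0P; exists (f x x).
  have : \sum_(c : C) (count (fun y => f x y == c) s).+1 <= #|C| * n.
    by rewrite -sum_nat_const; apply: leq_sum => c _; rewrite ltnNge.
  have -> : \sum_(c : C) (count (fun y => f x y == c) s).+1 = size s + #|C|.
    rewrite szE -[#|C|]muln1 -sum_nat_const -big_split /=.
    by apply: eq_bigr => c _; rewrite addn1.
  by move/leq_trans => /(_ _ hs); rewrite -[leqRHS]addn0 leq_add2l leqNgt C0.
have [|t [ts tk ht]] := IH f [seq y <- s | f x y == c]; first by rewrite size_filter.
have tc y : y \in t -> f x y = c by move/(mem_subseq ts); rewrite mem_filter => /andP[/eqP].
exists (x :: t); split => /=; first by rewrite eqxx (subseq_trans ts (filter_subseq _ _)).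
- by rewrite tk.
case=> [|i] [|j] [|j'] //= ij ij'; last exact: ht.
by rewrite !tc // mem_nth // tk.
Qed.

(** [sg j] will be the truth value of phi(a, b_j). Equal signs let the values at [a] cancel, so xor
    of memberships becomes xor of truth values of phi. *)
Definition has_grid (J : finType) (F : {set {set J}}) (sg : J -> bool) (K : nat) :=
  exists b b' c c' : nat -> J,
    (forall i, i < K -> sg (b i) = sg (b' i) /\ sg (c i) = sg (c' i)) /\
    forall l k, l < K -> k < K -> exists2 S, S \in F & forall i, i < K ->
      (b i \in S) (+) (b' i \in S) = (i == l) /\
      (c i \in S) (+) (c' i \in S) = (i == k).

(* End-homogeneity makes membership in the point chosen for (l, k) constant on
   later rows and columns, so that a symmetric difference of two consecutive
   rows, or columns, isolates l, or k. *)
Lemma grid_of_first_hits K : exists n m, forall (J : finType) (F : {set {set J}})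
    (sg : J -> bool) (r d : nat -> J),
  (forall i j, i < n -> j < m ->
     exists2 S, S \in F & first_hit r i S && first_hit d j S) ->
  has_grid F sg K.
Proof.
(* The [K] pairs use indices [2 * i + 1] and [2 * i + 2]; index 0 is kept because its colours force
   all later signs to agree. *)
pose k := (2 * K).+1.
have [n hn] := end_homogeneous (bool * {ffun 'I_k -> bool})%type k.
(* Columns are thinned first, against all [n] rows, and rows afterwards, against the [k] surviving
   columns; hence [m] may depend on [n]. *)
have [m hm] := end_homogeneous (bool * {ffun 'I_n -> bool})%type k.
exists n, m => J F sg r d hF.
pose P i j := odflt set0 [pick S in F | first_hit r i S && first_hit d j S].
have PP i j : i < n -> j < m -> [/\ P i j \in F,
  first_hit r i (P i j) & first_hit d j (P i j)].
  move=> i1 j1; rewrite /P; case: pickP => [S /and3P[]|no] //=.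
  by have [S SF h] := hF i j i1 j1; have := no S; rewrite SF h.
have [|t [ts tk ht]] := hm (fun j j' => (sg (d j'), [ffun i :
  'I_n => d j' \in P i j])) (iota 0 m).
  by rewrite size_iota.
have [|u [us uk hu]] := hn (fun i i' => (sg (r i'), [ffun j :
  'I_k => r i' \in P i (nth 0 t j)])) (iota 0 n).
  by rewrite size_iota.
have lt_nth v q a b : subseq v (iota 0 q) -> size v = k -> a < b -> b < k ->
  nth 0 v a < nth 0 v b.
  move=> vs vk ab bk; have : sorted ltn v by apply: subseq_sorted vs (iota_ltn_sorted 0
    q); apply: ltn_trans.
  by move/(sorted_ltn_nth ltn_trans)/(_ a b); rewrite !inE vk; apply => //;
    apply: ltn_trans bk.
have nth_bd v q a : subseq v (iota 0 q) -> size v = k -> a < k -> nth 0 v a < q.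
  move=> vs vk ak; have : nth 0 v a \in iota 0 q by apply: (mem_subseq vs);
    rewrite mem_nth ?vk.
  by rewrite mem_iota.
exists (fun i => r (nth 0 u (2 * i).+1)), (fun i => r (nth 0 u (2 * i).+2)),
  (fun i => d (nth 0 t (2 * i).+1)), (fun i => d (nth 0 t (2 * i).+2)); split.
  move=> i iK; split.
    by have /(congr1 fst) := hu 0 (2 * i).+1 (2 * i).+2 ltac:(rewrite /k;
      lia) ltac:(rewrite /k; lia).
  by have /(congr1 fst) := ht 0 (2 * i).+1 (2 * i).+2 ltac:(rewrite /k;
    lia) ltac:(rewrite /k; lia).
move=> l q lK qK.
have ul : (2 * l).+2 < k by rewrite /k; lia.
have tq : (2 * q).+2 < k by rewrite /k; lia.
have un := nth_bd u n _ us uk ul; have tm := nth_bd t m _ ts tk tq.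
have [SF /first_hitP[r1 r2] /first_hitP[d1 d2]] := PP _ _ un tm.
(* Pair [l] straddles the first hit, which is at its second member; earlier pairs are missed
   entirely, and later pairs agree by homogeneity. *)
exists (P (nth 0 u (2 * l).+2) (nth 0 t (2 * q).+2)) => // i iK.
have ui : (2 * i).+2 < k by rewrite /k; lia.
split.
  case: (ltngtP i l) => [il|li|->]; last by rewrite r1 (negPf (r2 _ _)) //;
    apply: (lt_nth u n) => //; lia.
    by rewrite !(negPf (r2 _ _)) //; apply: (lt_nth u n) => //; lia.
  have /(congr1 snd) := hu (2 * l).+2 (2 * i).+1 (2 * i).+2 ltac:(lia) ltac:(lia).
  by move=> /ffunP/(_ (Ordinal tq)); rewrite !ffunE /= => ->; rewrite addbb.
case: (ltngtP i q) => [iq|qi|->]; last by rewrite d1 (negPf (d2 _ _)) //;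
  apply: (lt_nth t m) => //; lia.
  by rewrite !(negPf (d2 _ _)) //; apply: (lt_nth t m) => //; lia.
have /(congr1 snd) := ht (2 * q).+2 (2 * i).+1 (2 * i).+2 ltac:(lia) ltac:(lia).
by move=> /ffunP/(_ (Ordinal un)); rewrite !ffunE /= => ->; rewrite addbb.
Qed.

(** * Majority votes *)

Definition trace (J Q : finType) (q : Q -> J) (S : {set J}) : {ffun Q -> bool} :=
  [ffun t => q t \in S].

(** A cell containing no trace decides both values. *)
Definition decides (J Q : finType) (F : {set {set J}}) (q : Q -> J)
    (g : {set {ffun Q -> bool}}) (b : bool) (j : J) :=
  [forall S in F, (trace q S \in g) ==> ((j \in S) == b)].

(** [false] is the correct value, since [a] has the empty difference set. *)
Definition majority (J Q I : finType) (F : {set {set J}}) (q : Q -> J)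
    (f : I -> {set {ffun Q -> bool}}) (j : J) :=
  #|[set i | decides F q (f i) true j]| < #|[set i | decides F q (f i) false j]|.

Section Window.

Variables (J : finType) (F A : {set {set J}}) (w : {set J} -> nat) (e N : nat) (c :
  nat -> J).
Hypotheses (AF : A \subset F) (e_gt0 : 0 < e).
Hypothesis hits_le : forall j, \sum_(S in A | j \in S) w S <= e.
Hypothesis first_hits_ge : forall i, i < N -> e <= 2 * \sum_(S in A | first_hit c i S) w S.

Let live (ds : seq J) (i : nat) (S : {set J}) :=
  [&& S \in F, first_hit c i S & all (fun d => d \notin S) ds].

(* The first-hit sets are disjoint and each has weight at least e/2, whereas
   every element of ds hits weight at most e. *)
Lemma few_exhausted ds :
  #|[set i : 'I_N | ~~ [exists S, live ds i S]]| <= 2 * size ds.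
Proof.
set I := [set i | _].
have uniq_hit i k S : first_hit c i S -> first_hit c k S -> i = k.
  move=> /first_hitP[ci ni] /first_hitP[ck nk].
  by case: (ltngtP i k) => // [/nk|/ni]; rewrite ?ci ?ck.
have h1 i : i \in I -> e <= 2 * \sum_(d <- ds) \sum_(S in A | first_hit c i S && (d \in
  S)) w S.
  rewrite inE negb_exists => /forallP no; apply: leq_trans (first_hits_ge (ltn_ord i)) _.
  rewrite leq_mul2l /=.
  rewrite (eq_bigr (fun d => \sum_(S in A | first_hit c i S) if d \in S then w S else
    0)); last first.
    by move=> d _; rewrite -big_mkcondr; apply: eq_bigl => S; rewrite andbA.
  rewrite exchange_big /=; apply: leq_sum => S /andP[SA hS].
  have := no S; rewrite /live (subsetP AF) //= hS /= -has_predC => /hasP[d dds /negPn dS].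
  by rewrite (big_rem d) //= dS leq_addr.
have h2 : #|I| * e <= 2 * (size ds * e).
  rewrite -sum_nat_const; apply: leq_trans; first by apply: leq_sum => i iI; exact: h1 iI.
  rewrite -big_distrr leq_mul2l /=.
  rewrite exchange_big /=.
  have -> : size ds * e = \sum_(d <- ds) e by rewrite big_const_seq count_predT
    iter_addn_0 mulnC.
  apply: leq_sum => d _; apply: leq_trans (hits_le d).
  under eq_bigr do rewrite big_mkcond.
  rewrite exchange_big [leqRHS]big_mkcond /=; apply: leq_sum => S _.
  case: (boolP (S \in A)) => SA /=; last by rewrite big1.
  case: (boolP (d \in S)) => dS; last by rewrite big1 // => i _; rewrite andbF.
  have [/existsP[i0 hi0]|] := boolP [exists i : 'I_N, first_hit c i S]; last first.
    by rewrite negb_exists => /forallP h; rewrite big1 // => i _; rewrite (negPf (h i)).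
  rewrite big_mkcond (bigD1 i0) //= big1 ?addn0 => [|i ne]; first by do !case: ifP.
  case: ifP => // _; case: ifP => // /andP[hi _]; case/eqP: ne.
  exact/val_inj/(uniq_hit _ _ S).
by move: h2; rewrite mulnA leq_pmul2r.
Qed.

Let half_grid (I : {set 'I_N}) ds := forall (i : 'I_N) j, i \in I -> j < size ds ->
  exists2 S, S \in F & first_hit c i S && first_hit (nth (c 0) ds) j S.

(** After discarding the exhausted rows, at least [2 * h] live ones remain. Either some [j] meets
    [h] of them and becomes a new column, or each [j] meets a minority and the live cells vote
    correctly. *)
Lemma majority_or_extend (M h : nat) (I : {set 'I_N}) ds :
  size ds <= M -> 0 < h -> 2 * h + 2 * size ds <= #|I| -> half_grid I ds ->
  (exists (q : 'I_N + 'I_M -> J) (f : 'I_N -> {set {ffun 'I_N + 'I_M -> bool}}),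
     forall j, majority F q f j) \/
  exists (I' : {set 'I_N}) j, h <= #|I'| /\ half_grid I' (rcons ds j).
Proof.
move=> dsM h0 Ih hg.
pose I1 := [set i in I | [exists S, live ds i S]].
have I1h : 2 * h <= #|I1|.
  have := few_exhausted ds; set X := [set i | _] => Xle.
  have : #|I| <= #|I1| + #|X|.
    apply: leq_trans (leq_card_setU I1 X); apply/subset_leq_card/subsetP => i iI.
    by rewrite !inE iI /=; case: [exists _, _].
  by lia.
pose meets j := [set i in I1 | [exists S, live ds i S && (j \in S)]].
have [/existsP[j hj]|] := boolP [exists j, h <= #|meets j|].
  right; exists (meets j), j; split => // i k;
    rewrite inE => /andP[iI1 /existsP[S /andP[lS jS]]].
  rewrite size_rcons ltnS leq_eqVlt => /orP[/eqP ->|kd].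
    case/and3P: lS => SF hS /allP nds; exists S => //; rewrite hS /=; apply/first_hitP.
    split; first by rewrite nth_rcons ltnn eqxx.
    by move=> l lds; rewrite nth_rcons lds; apply: nds; rewrite mem_nth.
  have iI : i \in I by move: iI1; rewrite inE => /andP[].
  have [S' S'F /andP[h1 /first_hitP[h2 h3]]] := hg i k iI kd.
  exists S' => //; rewrite h1 /=; apply/first_hitP; split; first by rewrite nth_rcons kd.
  by move=> l lk; rewrite nth_rcons (ltn_trans lk kd); apply: h3.
rewrite negb_exists => /forallP few; left.
(* The padding [c 0] is harmless: [ok] reads only positions below [size ds]. *)
pose q (t : 'I_N + 'I_M) := match t with inl i => c i | inr k => nth (c 0) ds k end.
pose ok (i : 'I_N) (v : {ffun 'I_N + 'I_M -> bool}) :=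
  [&& v (inl i), [forall k : 'I_N, (k < i) ==> ~~ v (inl k)] &
      [forall k : 'I_M, (k < size ds) ==> ~~ v (inr k)]].
(* Discarded rows get the empty cell, whose votes for the two values cancel. *)
exists q, (fun i => if i \in I1 then [set v | ok i v] else set0) => j.
have okE i S : S \in F -> ok i (trace q S) = live ds i S.
  move=> SF; rewrite /ok /live SF ffunE /= /first_hit -andbA; congr [&& _, _ & _].
    apply/forallP/forallP => [hk k|hk k]; last first.
      by apply/implyP => ki; rewrite ffunE; apply: (hk (Ordinal ki)).
    have := hk (Ordinal (ltn_trans (ltn_ord k) (ltn_ord i))).
    by rewrite /= ltn_ord ffunE.
  apply/forallP/allP => [hk d dds|hk k]; last first.
    by apply/implyP => kd; rewrite ffunE; apply: hk; rewrite mem_nth.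
  have di : index d ds < size ds by rewrite index_mem.
  by have := hk (Ordinal (leq_trans di dsM)); rewrite /= di ffunE /= nth_index.
rewrite /majority; set T1 := [set i | _]; set T0 := [set i | _].
have T1le : #|T1| <= #|meets j| + #|~: I1|.
  apply: leq_trans (leq_card_setU _ _); apply/subset_leq_card/subsetP => i.
  rewrite inE in_setU in_setC => /forallP hd.
  have [iI1|nI] := boolP (i \in I1); last by rewrite orbT.
  rewrite orbF inE iI1 /=.
  have /existsP[S lS] : [exists S, live ds i S] by move: iI1; rewrite inE => /andP[].
  apply/existsP; exists S; rewrite lS /=.
  have SF : S \in F by case/and3P: lS.
  by have := hd S; rewrite SF iI1 inE okE // lS /= => /eqP ->.
have T0ge : #|I1| - #|meets j| + #|~: I1| <= #|T0|.
  have sub : meets j \subset I1 by apply/subsetP => i; rewrite inE => /andP[].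
  have cD : #|I1 :\: meets j| = #|I1| - #|meets j| by rewrite cardsD (setIidPr sub).
  have dis : [disjoint I1 :\: meets j & ~: I1].
    by rewrite -setI_eq0; apply/eqP/setP => i; rewrite !inE; case: (i \in I);
      case: [exists _, _]; rewrite ?andbF.
  have := leq_card_setU (I1 :\: meets j) (~: I1); rewrite -cD => -[_];
    rewrite dis => /eqP <-.
  apply/subset_leq_card/subsetP => i iU; rewrite inE; apply/forallP => S;
    apply/implyP => SF.
  case: (boolP (i \in I1)) => iI1; last by rewrite inE.
  apply/implyP; rewrite inE okE // => lS; apply/eqP/negbTE/negP => jS.
  move: iU; rewrite in_setU in_setD in_setC iI1 orbF /= andbT inE iI1 /= => /negP; apply.
  by apply/existsP; exists S; rewrite lS jS.
by have := few j; rewrite -ltnNge; lia.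
Qed.

End Window.

Theorem majority_of_no_grid (d K : nat) : exists N M, forall (J : finType) (j0 : J)
    (F : {set {set J}}) (sg : J -> bool),
  set0 \in F -> (forall W, shatters F W -> #|W| < d) -> ~ has_grid F sg K ->
  exists (q : 'I_N + 'I_M -> J) (f : 'I_N -> {set {ffun 'I_N + 'I_M -> bool}}),
    forall j, majority F q f j.
Proof.
have [n1 [m1 hgrid]] := grid_of_first_hits K.
(* [need t] rows suffice when [t] columns are still to be found: a step discards at most [2 * m1]
   exhausted rows and then halves. *)
pose need t := iter t (fun x => 2 * x + 2 * m1) n1.+1.
have need_gt0 t : 0 < need t by elim: t => //= t; lia.
pose N := need m1.
have [m2 hnet] := epsilon_net d (4 * (2 * N)).
pose M := maxn m1 m2.
exists N, M => J j0 F sg F0 vc nogrid.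
pose X := F :\ set0.
have XF : X \subset F by apply: subsetDl.
have N0 : 0 < N by apply: need_gt0.
have [hw|hw] := boolp.pselect (forall w : {set J} -> nat,
    exists j, \sum_(S in X) w S <= 2 * N * \sum_(S in X | j \in S) w S).
  have [y hy] : exists y : {ffun 'I_m2 -> J}, forall S, S \in X -> exists i, y i \in S.
    have [||z [z0 hz]] := @fractional_cover J X (2 * N); [lia|by []|].
    case: z0 => [z0|X0]; last by exists [ffun=> j0] => S; rewrite X0 inE.
    by apply: hnet hz => // W /(shatters_sub XF)/vc.
  pose q (t : 'I_N + 'I_M) := match t with inl _ => j0 | inr k => if insub (k :
    nat) is Some i then y i else j0 end.
  (* The only member of [F] missed by the whole net is the empty set, so this cell decides [false]
     and never [true]. *)
  pose g := [set v : {ffun 'I_N + 'I_M -> bool} | [forall k :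
    'I_M, (k < m2) ==> ~~ v (inr k)]].
  exists q, (fun=> g) => j.
  have only0 S : S \in F -> trace q S \in g -> S = set0.
    move=> SF; rewrite inE => /forallP h; apply/eqP/negPn/negP => S0.
    have [|i yS] := hy S; first by rewrite !inE S0.
    have iM : i < M by apply: leq_trans (ltn_ord i) (leq_maxr _ _).
    by have := h (Ordinal iM); rewrite /= ltn_ord ffunE /= valK yS.
  rewrite /majority (_ : [set i | _] = set0); last first.
    apply/setP => i; rewrite !inE; apply/negbTE/negP => /forallP/(_ set0).
    rewrite F0 /= !inE /= implybF => /negP; apply; apply/forallP => k.
    by rewrite ffunE inE implybT.
  rewrite cards0; apply/card_gt0P; exists (Ordinal N0); rewrite inE.
  by apply/forallP => S; apply/implyP => SF; apply/implyP => /(only0 S SF) ->; rewrite inE.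
have [w hw'] : exists w : {set J} ->
  nat, forall j, 2 * N * \sum_(S in X | j \in S) w S < \sum_(S in X) w S.
  apply: boolp.contrapT => no; apply: hw => w.
  apply: boolp.contrapT => no'; apply: no; exists w => j.
  by rewrite ltnNge; apply/negP => h; apply: no'; exists j.
have [|A [e [c [AX e0 hits ge]]]] := greedy_window j0 _ hw'.
  by move=> S; rewrite !inE => /andP[].
have AF := subset_trans AX XF.
have ext s : s <= m1 ->
    (exists (q : 'I_N + 'I_M -> J) (f :
      'I_N -> {set {ffun 'I_N + 'I_M -> bool}}), forall j, majority F q f j) \/
    exists (I : {set 'I_N}) ds, [/\ size ds = s, need (m1 - s) <= #|I| &
      forall (i : 'I_N) j, i \in I -> j < size ds ->
      exists2 S, S \in F & first_hit c i S && first_hit (nth (c 0) ds) j S].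
  elim: s => [|s IH] sm.
    by right; exists [set: 'I_N], [::]; split => //; rewrite subn0 cardsT card_ord.
  have [|[I [ds [dss Ic hg]]]] := IH (ltnW sm); first by left.
  have [||||?|[I' [j [I'c hg']]]] :=
    @majority_or_extend J F A w e N c AF e0 hits ge M (need (m1 - s.+1)) I ds.
  - by rewrite dss (leq_trans (ltnW sm)) // leq_maxl.
  - exact: need_gt0.
  - by move: Ic; rewrite -subSS subSn //= dss; lia.
  - exact: hg.
  - by left.
  by right; exists I', (rcons ds j); split => //; rewrite size_rcons dss.
have [//|[I [ds [dss Ic hg]]]] := ext m1 (leqnn _).
exfalso; apply: nogrid; move: Ic; rewrite subnn /= => Ic.
(* Listing [I] in increasing order preserves first hits. *)
pose r k := c (nth 0 [seq val i | i <- enum I] k).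
apply: (hgrid _ _ _ r (nth (c 0) ds)) => i j i1 j1.
have szI : size [seq val i | i <- enum I] = #|I| by rewrite size_map cardE.
have iI : i < #|I| by apply: ltn_trans i1 Ic.
have [iN hN eN] : exists2 iN : 'I_N, iN \in I & nth 0 [seq val i | i <- enum I] i = iN.
  have : nth 0 [seq val i | i <- enum I] i \in [seq val i | i <- enum I] by rewrite
    mem_nth ?szI.
  by case/mapP => iN; rewrite mem_enum => ? ->; exists iN.
have [|S SF /andP[h1 h2]] := hg iN j hN; first by rewrite dss.
exists S => //; rewrite h2 andbT; case/first_hitP: h1 => h1 h3.
apply/first_hitP; rewrite /r eN; split => // k ki; apply: h3; rewrite -eN.
have : sorted ltn [seq val i | i <- enum I].
  have : subseq [seq val i | i <- enum I] (iota 0 N).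
    by rewrite -val_enum_ord map_subseq // enumT filter_subseq.
  by move/subseq_sorted; apply; [exact: ltn_trans|exact: iota_ltn_sorted].
by move/(sorted_ltn_nth ltn_trans)/(_ k i); rewrite !inE szI; apply => //; lia.
Qed.

From mathcomp Require Import boolp classical_sets functions cardinality.

Local Open Scope classical_set_scope.
Local Open Scope card_scope.

(** * Definable relations *)

Section Rename.

Variables (L : language) (M : structure L).

Lemma eval_rename V W (s : V -> W) (e : W -> M) (t : term L V) :
  eval e (rename_term s t) = eval (e \o s) t.
Proof. by elim: t => //= f u IH; congr fun_interp; apply/funext => i. Qed.

Lemma sat_rename V W (s : V -> W) (e : W -> M) (A : formula L V) :
  sat e (rename s A) <-> sat (e \o s) A.
Proof.
elim: A W s e => {V} [V|V t u|V r t|V A IHA B IHB|V A IHA] W s e //=.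
- by rewrite !eval_rename.
- suff -> : (fun i => eval e (rename_term s (t i))) = (fun i => eval (e \o s) (t i)) by [].
  by apply/funext => i; apply: eval_rename.
- by rewrite IHA IHB.
have E a : extend e a \o omap s = extend (e \o s) a by apply/funext => -[].
by split=> h a; have := h a; rewrite IHA E.
Qed.

(** Working with definable relations replaces syntactic constructions by closure properties. *)
Definition definable V (P : (V -> M) -> Prop) :=
  exists A : formula L V, forall e, sat e A <-> P e.

Implicit Types V W : Type.

Lemma definable_ext V (P Q : (V -> M) -> Prop) :
  (forall e, P e <-> Q e) -> definable P -> definable Q.
Proof. by move=> PQ [A hA]; exists A => e; rewrite hA. Qed.

Lemma definable_comp V W (s : V -> W) (P : (V -> M) -> Prop) :
  definable P -> definable (fun e : W -> M => P (e \o s)).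
Proof. by move=> [A hA]; exists (rename s A) => e; rewrite sat_rename hA. Qed.

Lemma definable_false V : definable (fun _ : V -> M => False).
Proof. by exists Falsum. Qed.

Lemma definable_imp V (P Q : (V -> M) -> Prop) :
  definable P -> definable Q -> definable (fun e => P e -> Q e).
Proof. by move=> [A hA] [B hB]; exists (Imp A B) => e /=; rewrite hA hB. Qed.

Lemma definable_not V (P : (V -> M) -> Prop) : definable P -> definable (fun e => ~ P e).
Proof. by move=> hP; apply: definable_imp hP (definable_false V). Qed.

Lemma definable_and V (P Q : (V -> M) -> Prop) :
  definable P -> definable Q -> definable (fun e => P e /\ Q e).
Proof.
move=> hP hQ; apply: definable_ext (definable_not (definable_imp hP (definable_not
  hQ))) => e.
by split=> [h|[p q] h]; [apply: contrapT => h'; apply: h => p q; apply: h'|apply: (h p q)].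
Qed.

Lemma definable_all V (P : (option V -> M) -> Prop) :
  definable P -> definable (fun e : V -> M => forall a, P (extend e a)).
Proof. by move=> [A hA]; exists (All A) => e /=; split=> h a; apply/hA. Qed.

Lemma definable_ex V (P : (option V -> M) -> Prop) :
  definable P -> definable (fun e : V -> M => exists a, P (extend e a)).
Proof.
move=> hP; apply: definable_ext (definable_not (definable_all (definable_not hP))) => e.
by split=> [/existsNP[a /contrapT]|[a Pa] h]; [exists a|apply: (h a)].
Qed.

Lemma definable_eq V (v w : V) : definable (fun e : V -> M => e v = e w).
Proof. by exists (Equal (Var v) (Var w)). Qed.

Lemma definable_seq (I : eqType) V (s : seq I) (P : I -> (V -> M) -> Prop) :
  (forall i, definable (P i)) -> definable (fun e => forall i, i \in s -> P i e).
Proof.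
move=> hP; elim: s => [|i s IH].
  by apply: definable_ext (definable_not (definable_false V)) => e; split=> [_ i|_ []].
apply: definable_ext (definable_and (hP i) IH) => e; split=> [[Pi h] k|h].
  by rewrite inE => /orP[/eqP->|/h].
by split=> [|k ks]; apply: h; rewrite inE ?eqxx // ks orbT.
Qed.

Lemma definable_forall (I : finType) V (P : I -> (V -> M) -> Prop) :
  (forall i, definable (P i)) -> definable (fun e => forall i, P i e).
Proof.
move=> hP; apply: definable_ext (definable_seq (enum I) hP) => e.
by split=> h i; [apply: h; rewrite mem_enum|].
Qed.

(** Disjunctive normal form: a disjunction, written with negations, over the truth tables accepted
    by [g]. *)
Lemma definable_bool (I : finType) V (P : I -> (V -> M) -> Prop) (g :
  {ffun I -> bool} -> bool) :
  (forall i, definable (P i)) -> definable (fun e => g [ffun i => `[< P i e >]]).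
Proof.
move=> hP.
have hu (u : {ffun I -> bool}) :
  definable (fun e => ~ forall i, if u i then P i e else ~ P i e).
  by apply/definable_not/definable_forall => i; case: (u i) => //; apply: definable_not.
apply: definable_ext (definable_not (definable_seq (enum [pred u | g u]) hu)) => e; split.
  move=> /existsNP[u /not_implyP[]]; rewrite mem_enum inE => gu /contrapT hi.
  suff -> : [ffun i => `[< P i e >]] = u by [].
  by apply/ffunP => i; rewrite ffunE; have := hi i; case: (u i) => h; apply/asboolP.
move=> gP h; apply: (h [ffun i => `[< P i e >]]); first by rewrite mem_enum.
by move=> i; rewrite ffunE; case: asboolP.
Qed.

End Rename.

(** * Uniform definitions over finite sets *)

Section UD.

Variables (L : language) (M : structure L).

Definition definable2 X Y (phi : (X -> M) -> (Y -> M) -> Prop) :=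
  definable (fun e : X + Y -> M => phi (e \o inl) (e \o inr)).

Lemma definable2_comp X Y W (phi : (X -> M) -> (Y -> M) -> Prop) (s : X -> W) (t : Y -> W) :
  definable2 phi -> definable (fun e : W -> M => phi (e \o s) (e \o t)).
Proof.
exact: (definable_comp (fun v : X + Y => match v with inl x => s x | inr y => t y end)).
Qed.

(* The finite parameter set is the range of a family b indexed by J. *)
Definition uniformly_defined (X Y : Type) (phi : (X -> M) -> (Y -> M) -> Prop) :=
  exists (Q : finType) (psi : (Y -> M) -> (Q * Y -> M) -> Prop), definable2 psi /\
    forall (J : finType) (b : J -> Y -> M), (exists j j', b j <> b j') ->
    forall a, exists c : Q -> J, forall j,
      psi (b j) (fun t => b (c t.1) t.2) <-> phi a (b j).

(* The choice of f is coded by the equalities between the parameter indexed by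
   Some f and the one indexed by None. *)
Lemma uniformly_defined_finite_cases (X : Type) (Y F Q : finType)
    (phi : (X -> M) -> (Y -> M) -> Prop) (psi : F -> (Y -> M) -> (Q * Y -> M) -> Prop) :
  (forall f, definable2 (psi f)) ->
  (forall (J : finType) (b : J -> Y -> M), (exists j j', b j <> b j') ->
    forall a, exists (f : F) (c : Q -> J), forall j,
      psi f (b j) (fun t => b (c t.1) t.2) <-> phi a (b j)) ->
  uniformly_defined phi.
Proof.
move=> dpsi hpsi.
exists (Q + option F)%type, (fun y p => exists f,
  (forall i, p (inr (Some f), i) = p (inr None, i)) /\ psi f y (fun t => p (inl t.1, t.2))).
split.
  have h f : definable (fun e : Y + (Q + option F) * Y -> M =>
      ~ ((forall i, e (inr (inr (Some f), i)) = e (inr (inr None, i))) /\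
         psi f (e \o inl) (fun t => e (inr (inl t.1, t.2))))).
    apply/definable_not/definable_and; first by apply: definable_forall => i;
      apply: definable_eq.
    exact: (definable2_comp inl (fun t => inr (inl t.1, t.2)) (dpsi f)).
  apply: definable_ext (definable_not (definable_forall h)) => e; split.
    by move=> /existsNP[f /contrapT]; exists f.
  by move=> [f hf] h'; apply: (h' f).
move=> J b nb a; have [j1 [j2 j12]] := nb; have [f [c hc]] := hpsi J b nb a.
exists (fun o => match o with
  | inl t => c t | inr None => j1 | inr (Some g) => if g == f then j1 else j2 end) => j.
rewrite -hc; split=> [[g [hg]]|h]; last by exists f; split=> //= i; rewrite eqxx.
have [->//|gf] := eqVneq g f.
by case: j12; apply/funext => i; have := hg i; rewrite /= (negPf gf).
Qed.

Lemma uniformly_defined_reindex X W Y (s : X -> W) (t : W -> X)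
    (phi : (W -> M) -> (Y -> M) -> Prop) : cancel t s ->
  uniformly_defined (fun a : X -> M => phi (a \o t)) -> uniformly_defined phi.
Proof.
move=> ts [Q [psi [dpsi h]]]; exists Q, psi; split=> // J b nb a.
have [c hc] := h J b nb (a \o s); exists c => j; rewrite hc.
suff -> : (a \o s) \o t = a by [].
by apply/funext => x /=; rewrite ts.
Qed.

(** Isolate the variable [None] and count the others among the parameters. The one-variable case
    gives [psi1]; its instances form a relation [phi2] in the remaining variables, to which the
    hypothesis on [X] applies. *)
Lemma uniformly_defined_option (X Y : finType) (phi : (option X -> M) -> (Y -> M) -> Prop) :
  (forall (Y : finType) (phi : (unit -> M) -> (Y -> M) -> Prop),
     definable2 phi -> uniformly_defined phi) ->
  (forall (Y : finType) (phi : (X -> M) -> (Y -> M) -> Prop),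
     definable2 phi -> uniformly_defined phi) ->
  definable2 phi -> uniformly_defined phi.
Proof.
move=> H1 HX dphi.
pose phi1 (x : unit -> M) (p : X + Y -> M) := phi (extend (p \o inl) (x tt)) (p \o inr).
have dphi1 : definable2 phi1.
  apply: definable_ext (definable2_comp (W := unit + (X + Y))
    (fun o => if o is Some x then inr (inl x) else inl tt) (fun y =>
      inr (inr y)) dphi) => e.
  rewrite /phi1; suff -> : e \o (fun o => if o is Some x then inr (inl x) else inl tt) =
    extend ((e \o inr) \o inl) ((e \o inl) tt) by [].
  by apply/funext => -[].
have [Q1 [psi1 [dpsi1 h1]]] := H1 _ _ dphi1.
pose join (x : X -> M) (y : Y -> M) (v : X + Y) :=
  match v with inl i => x i | inr i => y i end.
pose phi2 (x : X -> M) (p : option Q1 * Y -> M) :=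
  psi1 (join x (fun y => p (None, y))) (fun t => join x (fun y => p (Some t.1, y)) t.2).
have dphi2 : definable2 phi2.
  apply: definable_ext (definable2_comp (W := X + option Q1 * Y)
    (fun v => match v with inl i => inl i | inr i => inr (None, i) end)
    (fun v : Q1 * (X + Y) => match v.2 with inl i => inl i | inr i =>
      inr (Some v.1, i) end) dpsi1) => e.
  rewrite /phi2; set u := e \o _; set v := e \o _.
  have -> : u = join (e \o inl) (fun y => (e \o inr) (None, y)) by apply/funext => -[].
  suff -> : v = (fun t => join (e \o inl) (fun y => (e \o inr) (Some t.1, y)) t.2) by [].
  by apply/funext => -[? []].
have [Q2 [psi2 [dpsi2 h2]]] := HX _ _ dphi2.
(* In an instance of [phi2], slot [None] carries the argument and slots [Some q] the parameters
   fixed for [psi1]. *)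
pose own (b : Y -> M) (p : Q1 -> Y -> M) (t : option Q1 * Y) :=
  if t.1 is Some q then p q t.2 else b t.2.
exists (Q2 * option Q1 + Q1)%type, (fun b p =>
  psi2 (own b (fun q y => p (inr q, y))) (fun t => p (inl (t.1, t.2.1), t.2.2))).
split.
  apply: definable_ext (definable2_comp (W := Y + (Q2 * option Q1 + Q1) * Y)
    (fun t : option Q1 * Y => if t.1 is Some q then inr (inr q, t.2) else inl t.2)
    (fun t => inr (inl (t.1, t.2.1), t.2.2)) dpsi2) => e.
  set u := e \o _; suff -> : u = own (e \o inl) (fun q y => (e \o inr) (inr q, y)) by [].
  by apply/funext => -[[]].
move=> J b [j1 [j2 j12]] a.
have [|c1 hc1] := h1 J (fun j => join (a \o Some) (b j)) _ (fun=> a None).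
  by exists j1, j2 => e; apply: j12; apply/funext => i; have := congr1 (@^~ (inr i)) e.
have [|c2 hc2] := h2 {ffun option Q1 -> J} (fun g t => b (g t.1) t.2) _ (a \o Some).
  exists [ffun=> j1], [ffun=> j2] => e; apply: j12; apply/funext => i.
  by have := congr1 (@^~ (None, i)) e; rewrite !ffunE.
exists (fun o => match o with inl t => c2 t.1 t.2 | inr q => c1 q end) => j.
have := hc2 [ffun o => if o is Some q then c1 q else j].
set u := (fun t => b ([ffun o => if o is Some q then c1 q else j] t.1) t.2).
have -> : u = own (b j) (fun q y => b (c1 q) y).
  by apply/funext => -[[q|] i]; rewrite /u /own /= ffunE.
move=> ->; rewrite /phi2 /own /=.
have := hc1 j; rewrite /phi1.
have -> : extend (join (a \o Some) (b j) \o inl) (a None) = a by apply/funext => -[].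
by [].
Qed.

Lemma uniformly_defined_ord n (Y : finType) (phi : ('I_n -> M) -> (Y -> M) -> Prop) :
  (forall (Y : finType) (phi : (unit -> M) -> (Y -> M) -> Prop),
     definable2 phi -> uniformly_defined phi) ->
  definable2 phi -> uniformly_defined phi.
Proof.
move=> H1; elim: n Y phi => [|n IH] Y phi dphi.
  have [m0] := carrier_inhabited M.
  exists void, (fun y _ => phi (fun=> m0) y); split.
    apply: definable_ext (definable2_comp (W := Y + void * Y)
      (fun i : 'I_0 => match (elimF idP (erefl (i < 0)%N)) (ltn_ord i) with end) inl
        dphi) => e.
    by set u := e \o _; suff -> : u = (fun=> m0) by []; apply/funext => -[].
  move=> J b _ a; exists (fun v : void => match v with end) => j.
  by suff -> : (fun=> m0) = a by []; apply/funext => -[].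
pose s (o : option 'I_n) : 'I_n.+1 := if o is Some i then lift ord0 i else ord0.
apply: (@uniformly_defined_reindex _ _ _ s (unlift ord0)).
  by move=> i; case: unliftP => [k|] ->.
apply: uniformly_defined_option H1 IH _.
exact: (definable2_comp (fun i => inl (unlift ord0 i)) inr dphi).
Qed.

End UD.

(** * Saturation *)

Lemma finite_set_enum T (A : set T) : finite_set A ->
  exists n (f : 'I_n -> T), forall x, A x <-> exists i, f i = x.
Proof.
move=> [n /card_bijP[f [g fg gf]]]; exists n.
have In (i : 'I_n) : (i : nat) \in `I_n by apply/mem_set/ltn_ord.
exists (fun i : 'I_n => val (g (SigSub (In i)))) => x; split=> [Ax|[i <-]];
  last exact/set_mem/valP.
have fx := set_mem (valP (f (SigSub (mem_set Ax)))).
exists (Ordinal fx); set u := SigSub _.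
have -> : u = f (SigSub (mem_set Ax)) by apply: val_inj.
by rewrite fg.
Qed.

Lemma finite_set_bound T (A : set T) (P : nat -> T -> Prop) : finite_set A ->
  (forall x, A x -> exists k, P k x) ->
  exists K, forall x, A x -> exists2 k, (k <= K)%N & P k x.
Proof.
move=> /finite_set_enum[n [f fA]] hP.
have {hP} /choice[g hg] : forall i, exists k, P k (f i) by move=> i; apply: hP;
  apply/fA; exists i.
by exists (\max_i g i)%N => x /fA[i <-]; exists (g i) => //; apply: leq_bigmax.
Qed.

Section Compactness.

Variables (L : language) (M : structure L).

Definition upd (e : nat -> M) n a : nat -> M := fun i => if i == n then a else e i.

Lemma definable_ex_upd (P : (nat -> M) -> Prop) n :
  definable P -> definable (fun e => exists a, P (upd e n a)).
Proof.
move=> dP; have := definable_ex (definable_comp (fun i =>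
  if i == n then None else Some i) dP).
apply: definable_ext => e; split=> -[a ha]; exists a; move: ha.
  by congr P; apply/funext => i; rewrite /upd /=; case: eqP.
by congr P; apply/funext => i; rewrite /upd /=; case: eqP.
Qed.

(** As [P] reads only coordinates below [N], a finite block of quantifiers is enough. *)
Lemma definable_ex_above (P : (nat -> M) -> Prop) n N :
  (forall e e', (forall i, (i < N)%N -> e i = e' i) -> P e -> P e') ->
  definable P -> definable (fun e => exists e', (forall i, (i < n)%N ->
    e' i = e i) /\ P e').
Proof.
move=> local dP.
have block l : definable (fun e => exists e',
    (forall i, ~~ (n <= i < n + l)%N -> e' i = e i) /\ P e').
  elim: l => [|l IH].
    apply: definable_ext dP => e; split=> [Pe|[e' [ee' Pe']]]; first by exists e.
    suff <- : e' = e by [].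
    by apply/funext => i; apply: ee'; lia.
  apply: definable_ext (definable_ex_upd (n + l) IH) => e; split.
    move=> [a [e' [h Pe']]]; exists e'; split=> // i hi; rewrite h; last by lia.
    by rewrite /upd; case: eqP => // E; lia.
  move=> [e' [h Pe']]; exists (e' (n + l)%N), e'; split=> // i hi; rewrite /upd.
  by case: eqP => [->//|ne]; apply: h; lia.
apply: definable_ext (block (N - n)%N) => e; split=> -[e' [h Pe']].
  by exists e'; split=> // i hi; apply: h; lia.
exists (fun i => if (i < maxn n N)%N then e' i else e i); split.
  by move=> i hi; case: ifP => // ?; apply: h; lia.
by apply: local Pe' => i hi; rewrite (_ : (i < maxn n N)%N) //; lia.
Qed.

Variable K : Type.
Hypotheses (nat_lt_K : ~ ([set: K] #<= [set: nat])) (satM : saturated K M).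

(** Saturation realizes types in one variable, so coordinates are chosen one at a time. Monotonicity
    reduces finitely many conditions to one, and locality carries each condition to the limit. *)
Lemma saturated_nat (Q : nat -> (nat -> M) -> Prop) :
  (forall k, definable (Q k)) ->
  (forall k l e, (k <= l)%N -> Q l e -> Q k e) ->
  (forall k, exists N, forall e e', (forall i, (i < N)%N -> e i = e' i) -> Q k e ->
    Q k e') ->
  (forall k, exists e, Q k e) ->
  exists e, forall k, Q k e.
Proof.
move=> dQ mono local ex.
(* Invariant: the first [n] coordinates extend to a solution of each single [Q k]. *)
pose G n e := forall k, exists e', (forall i, (i < n)%N -> e' i = e i) /\ Q k e'.
have step n e : G n e -> exists a, G n.+1 (upd e n a).
  move=> Ge.
  have /choice[A hA] : forall k, exists A : formula L nat, forall e,
      sat e A <-> exists e', (forall i, (i < n.+1)%N -> e' i = e i) /\ Q k e'.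
    by move=> k; have [N hN] := local k; apply: definable_ex_above hN (dQ k).
  pose D := [set e i | i in `I_n].
  have De i : (i < n)%N -> e i \in D by move=> hi; apply/mem_set; exists i.
  (* Coordinates below [n] become parameters, all others the one variable; the truth of [A k]
     depends only on coordinates up to [n]. *)
  pose s i : 'I_1 + D := if @idP (i < n)%N is ReflectT h then inr (SigSub (De i h))
    else inl ord0.
  pose f k := inst (rename s (A k)) (fun d : D => val d) : pformula M 'I_1.
  have fE (a : 'I_1 -> M) k : psat a (f k) <-> sat (fun i =>
    if (i < n)%N then e i else a ord0) (A k).
    rewrite /psat /f /inst !sat_rename; set u := (pval a \o _) \o _.
    suff -> : u = (fun i => if (i < n)%N then e i else a ord0) by [].
    by apply/funext => i; rewrite /u /= /s; case: {-}_ / idP => [h|/negP/negbTE h];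
      rewrite ?h.
  have cD : card_lt D [set: K].
    move=> KD; apply: nat_lt_K; apply: card_le_trans KD _; apply: finite_set_countable.
    exact/finite_image/finite_II.
  have [||a ha] := satM cD (p := range f).
  - by move=> _ [k _ <-]; exists (rename s (A k)).
  - move=> F finF Ff.
    have [|k0 hk0] := @finite_set_bound _ F (fun k B => f k = B) finF.
      by move=> B /Ff[k _ <-]; exists k.
    have [e' [ee' Qe']] := Ge k0.
    exists (fun=> e' n) => B /hk0[k kk0 <-]; apply/fE/hA; exists e'; split;
      last exact: mono Qe'.
    move=> i; rewrite ltnS leq_eqVlt => /orP[/eqP ->|hi]; first by rewrite ltnn.
    by rewrite hi ee'.
  exists (a ord0) => k; have /fE/hA[e' [h Qe']] : psat a (f k) by apply: ha; exists k.
  exists e'; split=> // i hi; rewrite h // /upd.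
  by case: eqP => [->|ne]; rewrite ?ltnn // (_ : (i < n)%N) //; lia.
have [m0] := carrier_inhabited M.
have /choice[next hnext] : forall ne :
  nat * (nat -> M), exists a, G ne.1 ne.2 -> G ne.1.+1 (upd ne.2 ne.1 a).
  move=> [n e]; have [/step[a ha]|] := pselect (G n e); first by exists a.
  by exists m0.
pose E := fix E n := if n is n'.+1 then upd (E n') n' (next (n', E n')) else (fun=> m0).
have GE n : G n (E n).
  elim: n => [|n IH]; first by move=> k; have [e' Qe'] := ex k; exists e'; split.
  exact: (hnext (n, E n)).
have EE i n : (i < n)%N -> E n i = E i.+1 i.
  elim: n => // n IH; rewrite ltnS leq_eqVlt => /orP[/eqP->//|hi].
  by rewrite /= {1}/upd (_ : (i == n) = false) ?IH //; lia.
exists (fun i => E i.+1 i) => k; have [N hN] := local k.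
have [e' [h Qe']] := GE N k; apply: hN Qe' => i hi; by rewrite h // EE.
Qed.

End Compactness.

(** * A single variable *)

Section OneVariable.

Variables (L : language) (M : structure L) (Y : finType).
Variable phi : (unit -> M) -> (Y -> M) -> Prop.
Hypothesis dphi : definable2 phi.

Let val1 (x : M) (y : Y -> M) : bool := `[< phi (fun=> x) y >].

(** A finite ICT pattern for phi(x,y) xor phi(x,y'): the first boolean selects rows or columns, the
    second the member of the pair. *)
Definition xor_pattern K (b : bool * bool -> nat -> Y -> M) :=
  forall l k : 'I_K, exists x, forall i : 'I_K,
    (val1 x (b (true, true) i) (+) val1 x (b (true, false) i) == (i == l)) &&
    (val1 x (b (false, true) i) (+) val1 x (b (false, false) i) == (i == k)).

Lemma xor_pattern_le K K' b : (K <= K')%N -> xor_pattern K' b -> xor_pattern K b.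
Proof.
move=> KK' h l k; have [x hx] := h (widen_ord KK' l) (widen_ord KK' k).
by exists x => i; apply: (hx (widen_ord KK' i)).
Qed.

Let dec (e : nat -> M) (s : bool * bool) (i : nat) (y : Y) : M := e (pickle (s, i, y)).

Let definable_val1 V (x : V) (y : Y -> V) :
  definable (fun e : V -> M => phi (fun=> e x) (e \o y)).
Proof. exact: (definable2_comp (fun=> x) y dphi). Qed.

Let definable_pattern K : definable (fun e => xor_pattern K (dec e)).
Proof.
apply: definable_forall => l; apply: definable_forall => k.
have h (i : 'I_K) := @definable_bool L M _ (option nat)
  (fun s e => phi (fun=> e None) (e \o (fun y => Some (pickle (s, i : nat, y)))))
  (fun u => (u (true, true) (+) u (true, false) == (i == l)) &&
            (u (false, true) (+) u (false, false) == (i == k)))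
  (fun s => definable_val1 _ _).
apply: definable_ext (definable_ex (definable_forall h)) => e.
by split=> -[x hx]; exists x => i; have := hx i; rewrite !ffunE.
Qed.

Let chi_ex : exists chi : formula L ('I_1 + 'I_#|{: bool * Y}|), forall e,
  sat e chi <-> val1 (e (inl ord0)) (fun y => e (inr (enum_rank (true, y)))) (+)
                val1 (e (inl ord0)) (fun y => e (inr (enum_rank (false, y)))).
Proof.
have := @definable_bool L M _ ('I_1 + 'I_#|{: bool * Y}|)
  (fun s e => phi (fun=> e (inl ord0)) (e \o (fun y => inr (enum_rank (s, y)))))
  (fun u => u true (+) u false) (fun s => definable_val1 _ _).
by apply: definable_ext => e; rewrite !ffunE.
Qed.

Variable K0 : Type.
Hypotheses (nat_lt_K0 : ~ ([set: K0] #<= [set: nat])) (satM : saturated K0 M).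
Hypothesis dpM : dp_minimal M.

(** Patterns of all finite sizes would give, by saturation, one infinite pattern, which is an ICT
    pattern with [chi] in both coordinates. *)
Lemma dp_minimal_bound : exists K, forall b, ~ xor_pattern K b.
Proof.
apply: contrapT => no.
have {no} all K : exists b, xor_pattern K b.
  by apply: contrapT => h; apply: no; exists K => b hb; apply: h; exists b.
have [||||e he] := saturated_nat nat_lt_K0 satM (Q := fun K e => xor_pattern K (dec e)).
- exact: definable_pattern.
- by move=> k l e; apply: xor_pattern_le.
- move=> K; exists (\max_(t : (bool * bool) * 'I_K * Y) pickle (t.1.1, t.1.2 :
    nat, t.2)).+1.
  move=> e e' ee' h l k; have [x hx] := h l k; exists x => i; have := hx i.
  suff E s : dec e' s i = dec e s i by rewrite !E.
  apply/funext => y; rewrite /dec ee' // ltnS.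
  exact: (leq_bigmax (F := fun t : (bool * bool) * 'I_K * Y => pickle (t.1.1, t.1.2 :
    nat, t.2)) (s, i, y)).
- move=> K; have [b hb] := all K; have [m0] := carrier_inhabited M.
  exists (fun n => if unpickle n is Some (s, i, y) then b s i y else m0).
  suff -> : dec (fun n => if unpickle n is Some (s, i, y) then b s i y else m0) = b by [].
  by apply/funext => s; apply/funext => i; apply/funext => y; rewrite /dec pickleK.
apply: dpM; have [chi chiE] := chi_ex.
pose par s i (t : 'I_#|{: bool * Y}|) := dec e (s, (enum_val t).1) i (enum_val t).2.
exists _, _, chi, chi, (par true), (par false) => l k F finF Fl.
have satE s i a : psat a (inst chi (par s i)) <->
    val1 (a ord0) (dec e (s, true) i) (+) val1 (a ord0) (dec e (s, false) i).
  rewrite /psat /inst sat_rename chiE /=.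
  have E u : (fun y => par s i (enum_rank (u, y))) = dec e (s, u) i.
    by apply/funext => y; rewrite /par enum_rankK.
  by rewrite !E.
pose P n (A : pformula M 'I_1) := [\/ A = inst chi (par true l), A = inst chi (par false k),
  exists i, [/\ i <> l, (i <= n)%N & A = Neg (inst chi (par true i))] |
  exists i, [/\ i <> k, (i <= n)%N & A = Neg (inst chi (par false i))]].
have [|n hn] := @finite_set_bound _ F P finF.
  move=> A /Fl[[[->|->]|[i il <-]]|[i ik <-]]; [by exists 0; apply: Or41|by exists 0;
    apply: Or42| |].
    by exists i; apply: Or43; exists i.
  by exists i; apply: Or44; exists i.
(* The finitely many formulas involve only [l], [k] and indices up to [n], so a finite pattern
   satisfies them. *)
pose K := (l + k + n).+1.
have lK : (l < K)%N by rewrite /K; lia.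
have kK : (k < K)%N by rewrite /K; lia.
have [x hx] := he K (Ordinal lK) (Ordinal kK).
have row i : (i < K)%N -> psat (fun=> x) (inst chi (par true i)) <-> i = l.
  move=> iK; rewrite satE; have /andP[/eqP -> _] := hx (Ordinal iK).
  by rewrite -val_eqE /=; split=> /eqP.
have col i : (i < K)%N -> psat (fun=> x) (inst chi (par false i)) <-> i = k.
  move=> iK; rewrite satE; have /andP[_ /eqP ->] := hx (Ordinal iK).
  by rewrite -val_eqE /=; split=> /eqP.
exists (fun=> x) => A /hn[n' n'n [->|->|[i [il iN ->]]|[i [ik iN ->]]]].
- exact/row.
- exact/col.
- by move=> /row h; apply/il/h; rewrite /K; lia.
- by move=> /col h; apply/ik/h; rewrite /K; lia.
Qed.

Section Family.

Variables (J : finType) (b : J -> Y -> M) (a : M).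

Let diff x := [set j | val1 x (b j) != val1 a (b j)]%SET.
Let F := [set S : {set J} | `[< exists x, S = diff x >]]%SET.

Let diffF x : diff x \in F.
Proof. by rewrite inE; apply/asboolP; exists x. Qed.

Let in_diff x j : (j \in diff x) = (val1 x (b j) (+) val1 a (b j)).
Proof. by rewrite inE; case: val1; case: val1. Qed.

Lemma grid_xor_pattern K : has_grid F (fun j => val1 a (b j)) K ->
  exists b', xor_pattern K b'.
Proof.
move=> [r [r' [c [c' [sg h]]]]].
exists (fun s i => b (match s with (true, true) => r i | (true, false) => r' i
  | (false, true) => c i | (false, false) => c' i end)) => l k.
have [S SF hx] := h l k (ltn_ord l) (ltn_ord k).
have [x SE] : exists x, S = diff x by move: SF; rewrite inE => /asboolP.
exists x => i; have [hr hc] := hx i (ltn_ord i); have [sr sc] := sg i (ltn_ord i).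
rewrite -!val_eqE /=; move: hr hc; rewrite SE !in_diff sr sc => <- <-.
by rewrite !(addbACA _ (val1 a _)) !addbb !addbF !eqxx.
Qed.

(** The shattered points are cut into [K] quadruples, two points for a row and two for a column.
    Shattering makes phi(x, .) true at one point of row [l] and one of column [k], and nowhere else
    among them. *)
Lemma shatters_xor_pattern K W (j0 : J) :
  shatters F W -> (4 * K <= #|W|)%N -> exists b', xor_pattern K b'.
Proof.
move=> /shattersP sh KW; pose w n := nth j0 (enum W) n.
have wW n : (n < 4 * K)%N -> w n \in W.
  by move=> nK; rewrite -mem_enum mem_nth // -cardE (leq_trans nK).
have w_eq n n' : (n < 4 * K)%N -> (n' < 4 * K)%N -> (w n == w n') = (n == n').
  by move=> nK n'K; rewrite nth_uniq ?enum_uniq // -cardE ?(leq_trans nK) ?(leq_trans n'K).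
exists (fun (s : bool * bool) i => b (w (4 * i + 2 * s.1 + s.2)%N)) => l k.
pose V := [set w (4 * l + 3)%N; w (4 * k + 1)%N]%SET.
have [|S SF SW] := sh [set j in W | (j \in V) (+) val1 a (b j)]%SET.
  by apply/fintype.subsetP => j; rewrite inE => /andP[].
have [x SE] : exists x, S = diff x by move: SF; rewrite inE => /asboolP.
have xV n : (n < 4 * K)%N -> val1 x (b (w n)) = (w n \in V).
  move=> nK; have /setP/(_ (w n)) := SW;
    rewrite SE finset.in_setI in_diff [RHS]inE (wW n nK) /= andbT.
  exact: addIb.
exists x => i; have iK := ltn_ord i; have lK := ltn_ord l; have kK := ltn_ord k.
rewrite !xV /=; try lia.
rewrite !inE !w_eq; try lia.
by rewrite -!val_eqE /=; apply/andP; split; apply/eqP; lia.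
Qed.

Let diff0 : finset.set0 \in F.
Proof.
by rewrite inE; apply/asboolP; exists a; apply/setP => j; rewrite !inE eqxx.
Qed.

Lemma majority_exists K N P (j0 : J) : (forall b', ~ xor_pattern K b') ->
  (forall (J : finType) (j0 : J) (F : {set {set J}}) (sg : J -> bool),
    finset.set0 \in F -> (forall W, shatters F W -> (#|W| < 4 * K)%N) ->
      ~ has_grid F sg K ->
    exists (q : 'I_N + 'I_P -> J) (f : 'I_N -> {set {ffun 'I_N + 'I_P -> bool}}),
      forall j, majority F q f j) ->
  exists (q : 'I_N + 'I_P -> J) (f : 'I_N -> {set {ffun 'I_N + 'I_P -> bool}}), forall j,
    let votes v := [set i | `[< forall x, [ffun t => val1 x (b (q t))] \in f i ->
                                val1 x (b j) = v >]]%SET in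
    (#|votes (~~ val1 a (b j))| < #|votes (val1 a (b j))|)%N.
Proof.
move=> noK hm; have [|W shW|hg|q [f hf]] := hm J j0 F (fun j => val1 a (b j)).
- exact: diff0.
- rewrite ltnNge; apply/negP => KW.
  by have [b' /noK] := shatters_xor_pattern j0 shW KW.
- by have [b' /noK] := grid_xor_pattern hg.
(* Cells are translated by the truth values of [a], turning traces of [diff x] into truth patterns
   of [x]. *)
exists q, (fun i => [set u : {ffun 'I_N + 'I_P -> bool} |
  [ffun t => u t (+) val1 a (b (q t))] \in f i]%SET) => j; set votes := (fun v => _) => /=.
have votesE v : votes (v (+) val1 a (b j)) = [set i | decides F q (f i) v j]%SET.
  have trE x : trace q (diff x) =
      [ffun t => [ffun t => val1 x (b (q t))] t (+) val1 a (b (q t))].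
    by apply/ffunP => t; rewrite !ffunE in_diff.
  apply/setP => i; rewrite !inE; apply/asboolP/forallP => [h S|h x].
    apply/implyP; rewrite inE => /asboolP[x ->]; apply/implyP; rewrite trE => hx.
    by rewrite in_diff h ?inE // -addbA addbb addbF.
  rewrite inE -trE => hx; have := h (diff x); rewrite diffF hx /= in_diff => /eqP <-.
  by rewrite -addbA addbb addbF.
have := hf j; rewrite /majority -!votesE.
by rewrite addTb addFb.
Qed.

End Family.

(** For fixed cells [f] the comparison of votes is first-order. The cells depend on [a] but range
    over a finite set, which [uniformly_defined_finite_cases] absorbs. *)
Lemma uniformly_defined_unit : uniformly_defined phi.
Proof.
have [K noK] := dp_minimal_bound.
have [N [P hm]] := majority_of_no_grid (4 * K) K.
pose Q := ('I_N + 'I_P)%type.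
pose tp x (p : Q * Y -> M) : {ffun Q -> bool} := [ffun t => val1 x (fun y => p (t, y))].
pose votes (f : {ffun 'I_N -> {set {ffun Q -> bool}}}) v y p :=
  [set i | `[< forall x, tp x p \in f i -> val1 x y = v >]]%SET.
apply: (@uniformly_defined_finite_cases L M unit Y {ffun 'I_N -> {set {ffun Q ->
  bool}}} Q phi
  (fun f y p => (#|votes f false y p| < #|votes f true y p|)%N)) => [f|J b nb a].
  have dv (vi : bool * 'I_N) : definable (fun e : Y + Q * Y -> M =>
      forall x, tp x (e \o inr) \in f vi.2 -> val1 x (e \o inl) = vi.1).
    have d1 := @definable_bool L M Q (option (Y + Q * Y))
      (fun t e => phi (fun=> e None) (e \o (fun y => Some (inr (t, y)))))
      (fun u => u \in f vi.2) (fun t => definable_val1 _ _).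
    have d2 := @definable_bool L M unit (option (Y + Q * Y))
      (fun t e => phi (fun=> e None) (e \o (fun y => Some (inl y))))
      (fun u => u tt == vi.1) (fun t => definable_val1 _ _).
    apply: definable_ext (definable_all (definable_imp d1 d2)) => e.
    split=> h x; have := h x; rewrite ffunE => {}h hx; first exact/eqP/h.
    exact/eqP/h.
  have := definable_bool (fun u => (#|[set i | u (false, i)]%SET| < #|[set i | u (true,
    i)]%SET|)%N) dv.
  apply: definable_ext => e.
  suff E v : [set i | [ffun vi : bool * 'I_N => `[< forall x, tp x (e \o inr) \in f vi.2 ->
      val1 x (e \o inl) = vi.1 >]] (v,
        i)]%SET = votes f v (e \o inl) (e \o inr) by rewrite !E.
  by apply/setP => i; rewrite !inE ffunE.
have [j0 _] := nb.
have [q [f hf]] := majority_exists b (a tt) j0 noK hm.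
exists [ffun i => f i], q => j.
have E v : votes [ffun i => f i] v (b j) (fun t => b (q t.1) t.2) =
    [set i | `[< forall x, [ffun t => val1 x (b (q t))] \in f i -> val1 x (b j) = v >]]%SET.
  by apply/setP => i; rewrite !inE ffunE.
have phiE : phi a (b j) <-> val1 (a tt) (b j).
  by rewrite /val1 (_ : (fun=> a tt) = a); [split=> /asboolP|apply/funext => -[]].
have := hf j; rewrite /= !E phiE.
by case: (val1 (a tt) (b j)) => /= lt; split=> //; rewrite ltnNge ltnW.
Qed.

End OneVariable.

(** * From types over finite sets to UDTFS *)

(** Over a finite [B] the type is finite, so consistency realizes it by some [a]; maximality puts
    every instance true of [a] into it. *)
Lemma phi_type_realized (L : language) (C : structure L) n m
    (phi : formula L ('I_n + 'I_m)) (B : set ('I_m -> C)) p :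
  finite_set B -> phi_types phi B p ->
  exists a, forall b, B b -> (p (inst phi b) <-> psat a (inst phi b)).
Proof.
move=> finB [pB pcons pmax].
have finp : finite_set p.
  by apply: sub_finite_set pB _; rewrite finite_setU; split; apply: finite_image.
have [a ha] := pcons p finp (fun _ h => h).
exists a => b Bb; split; first exact: ha.
pose q := phi_formulas phi B `&` [set A | psat a A].
have <- : q = p.
  apply: pmax => [A []//|F _ Fq|A pA]; first by exists a => A /Fq[].
  by split; [apply: pB|apply: ha].
by move=> h; split=> //; left; exists b.
Qed.

Lemma formula_UDTFS_of_uniformly_defined (L : language) (C : structure L) n m
    (phi : formula L ('I_n + 'I_m)) :
  uniformly_defined (fun (x : 'I_n -> C) (y : 'I_m -> C) => psat x (inst phi y)) ->
  formula_UDTFS C phi.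
Proof.
move=> [Q [psi [dpsi h]]].
have [A hA] := definable2_comp (W := 'I_m + 'I_#|Q| * 'I_m) inl
  (fun t : Q * 'I_m => inr (enum_rank t.1, t.2)) dpsi.
exists #|Q|, A => B finB B2 p pB.
have [a ha] := phi_type_realized finB pB.
have [k [b bB]] := finite_set_enum finB.
have [|c hc] := h 'I_k b _ a.
  apply: contrapT => no.
  have /card_leP[g] := B2.
  have lt0 : (0 : nat) \in `I_2 by apply/mem_set.
  have lt1 : (1 : nat) \in `I_2 by apply/mem_set.
  have eqB (u v : B) : u = v.
    apply: val_inj.
    have [i <-] := (bB _).1 (set_mem (valP u)); have [j <-] := (bB _).1 (set_mem (valP v)).
    by apply: contrapT => ij; apply: no; exists i, j.
  by have /(congr1 val) := 'inj_g (mem_set I) (mem_set I) (eqB (g (SigSub lt0)) (g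
    (SigSub lt1))).
exists (fun i => b (c (enum_val i))); split=> [i|x /bB[j <-]].
  by apply/bB; exists (c (enum_val i)).
rewrite ha; last by apply/bB; exists j.
rewrite -hc /psat sat_rename hA.
have <- : (fun t : Q * 'I_m => b (c (enum_val (enum_rank t.1))) t.2) = (fun t =>
  b (c t.1) t.2).
  by apply/funext => t; rewrite enum_rankK.
exact: iff_refl.
Qed.

Theorem theorem3p1 (L : language) (T : theory L) (C : structure L)
    (T_complete : complete_theory T) (C_monster : monster_model T C) :
  dp_minimal C -> has_UDTFS C.
Proof.
move=> dpC n m phi; have [_ [K [ltK satC _]]] := C_monster.
(* [K] exceeds the number of symbols plus aleph_0, so it is uncountable. *)
have nat_lt_K : ~ ([set: K] #<= [set: nat]).
  move=> KN; apply: ltK; apply: card_le_trans KN _.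
  pose f := @inr (fun_sym L + rel_sym L)%type nat.
  have /inj_card_eq : {in [set: nat] &, injective f} by move=> i j _ _ [].
  rewrite card_eq_le => /andP[_ Nf]; exact: card_le_trans Nf (card_leT _).
apply: formula_UDTFS_of_uniformly_defined; apply: uniformly_defined_ord.
  by move=> Y psi dpsi; apply: (uniformly_defined_unit dpsi nat_lt_K satC dpC).
exists phi => e; rewrite /psat sat_rename.
suff -> : pval (e \o inl) \o inst_var (e \o inr) = e by [].
by apply/funext => -[].
Qed.
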